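(* Let $N\ge1$, $m>1$, $q\in(0,1)$, $\sigma=\frac{2(1-q)}{m-1}$, and assume $m+q>2$. Then there exists an exponent $\beta_0>0$ such that, for any $\beta\in[\beta_0,\infty)$ and corresponding $\alpha=\frac{2}{m-1}\beta\in[\alpha_0,\infty)$, where $\alpha_0=\frac{2}{m-1}\beta_0$, there exists a unique non-negative radially symmetric self-similar solution in exponential form $$U(t,x)=e^{-\alpha t}f\big(|x|e^{\beta t}\big),\qquad (t,x)\in\mathbb{R}\times\mathbb{R}^N,$$ to the equation $\partial_t u-\Delta u^m+|x|^\sigma u^q=0$, where the profile $f$ is a solution to $$(f^m)''(\xi)+\frac{N-1}{\xi}(f^m)'(\xi)+\alpha f(\xi)-\beta\xi f'(\xi)-\xi^\sigma f^q(\xi)=0,\qquad \xi>0,$$ such that $f(0)=0$ and $\mathrm{supp}\,f=[0,1]$. Moreover, the profile $f$ has the following local behavior at the origin: $$f(\xi)=\left[\frac{(m-1)^2}{2m[N(m-1)+2]}\right]^{1/(m-q)}\xi^{2/(m-1)}+o\big(\xi^{2/(m-1)}\big)\quad\text{as }\xi\to0.$$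
   Context: $N\ge1$ is the space dimension. A self-similar solution in exponential form is a function $u(t,x)=e^{-\alpha t}f(|x|e^{\beta t})$ with $\alpha=\frac{2}{m-1}\beta$, $\beta>0$, whose profile $f$ solves the ordinary differential equation $(f^m)''(\xi)+\frac{N-1}{\xi}(f^m)'(\xi)+\alpha f(\xi)-\beta\xi f'(\xi)-\xi^\sigma f^q(\xi)=0$, $\xi>0$; it is then a (weak) solution of the partial differential equation $\partial_t u-\Delta u^m+|x|^\sigma u^q=0$ on $\mathbb{R}\times\mathbb{R}^N$. Here a solution (profile) with $f(0)=0$ and support $[0,1]$ is a continuous function $f:[0,\infty)\to[0,\infty)$ with $f^m\in C^1([0,\infty))$ such that $f(0)=0$, $f=0$ on $[1,\infty)$, $f>0$ on $(0,1)$, the differential equation holds in the classical sense on $(0,1)$, and $(f^m)'(0)=(f^m)'(1)=0$ (the last condition at $\xi=1$ being the interface condition). *)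

(* Defs.v *)
From HB Require Import structures.
From mathcomp Require Import all_boot all_order all_algebra.
From mathcomp Require Import all_classical all_reals all_analysis.
Set Implicit Arguments.
Unset Strict Implicit.
Unset Printing Implicit Defensive.
Import Order.TTheory GRing.Theory Num.Theory.
Import numFieldNormedType.Exports.
Local Open Scope classical_set_scope.
Local Open Scope ring_scope.

(* The norm that MathComp-Analysis puts on 'rV[R]_N is the sup norm, whereas
   |x| is the Euclidean one. *)
Definition eucl_norm (R : realType) (N : nat) (x : 'rV[R]_N) : R :=
  Num.sqrt (\sum_(i < N) x 0 i ^+ 2).

(* F belongs to C^1([0, +oo)) with derivative dF; the derivative at the
   endpoint 0 is one-sided.  Only the values of F and dF on [0, +oo) matter. *)
Definition C1_halfline (R : realType) (F dF : R -> R) : Prop :=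
  [/\ forall x : R, 0 < x -> is_derive x 1 F (dF x),
      (fun h : R => h^-1 * (F h - F 0)) @ 0^'+ --> dF 0 &
      {within `[0, +oo[%classic, continuous dF}].

(* The equation
     (f^m)'' + (N-1)/xi (f^m)' + alpha f - beta xi f' - xi^sigma f^q = 0
   at the point xi, in the classical sense; dw stands for (f^m)'. *)
Definition profile_ode (R : realType) (N : nat) (q sigma alpha beta : R)
    (f dw : R -> R) (xi : R) : Prop :=
  [/\ derivable f xi 1, derivable dw xi 1 &
      derive1 dw xi + (N%:R - 1) / xi * dw xi + alpha * f xi
        - beta * xi * derive1 f xi - xi `^ sigma * f xi `^ q = 0].

(* f vanishes at 0, has support [0, 1], and satisfies the interface condition
   (f^m)'(1) = 0.  Profiles are functions on [0, +oo): the values of the total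
   function f on negative numbers are irrelevant. *)
Definition is_profile (R : realType) (N : nat) (m q sigma alpha beta : R)
    (f : R -> R) : Prop :=
  [/\ {within `[0, +oo[%classic, continuous f},
      forall xi : R, 0 <= xi -> 0 <= f xi,
      f 0 = 0,
      (forall xi : R, 0 < xi -> xi < 1 -> 0 < f xi) /\
      (forall xi : R, 1 <= xi -> f xi = 0) &
      exists dw : R -> R,
        [/\ C1_halfline (fun xi : R => f xi `^ m) dw,
            dw 0 = 0, dw 1 = 0 &
            forall xi : R, 0 < xi -> xi < 1 ->
              profile_ode N q sigma alpha beta f dw xi]].

(* U is the self-similar solution in exponential form of
     d_t u - Laplacian(u^m) + |x|^sigma u^q = 0   on R x R^N
   with profile f: by definition, U has the form below and its profile solves
   the ordinary differential equation. *)
Definition exp_self_similar_solution (R : realType) (N : nat)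
    (m q sigma alpha beta : R) (U : R -> 'rV[R]_N -> R) (f : R -> R) : Prop :=
  is_profile N m q sigma alpha beta f /\
  forall (t : R) (x : 'rV[R]_N),
    U t x = expR (- alpha * t) * f (eucl_norm x * expR (beta * t)).

(* Main.v *)
Require Import Defs.
From HB Require Import structures.
From mathcomp Require Import all_boot all_order all_algebra.
From mathcomp Require Import all_classical all_reals all_analysis.
From mathcomp Require Import ring lra.
Import Order.TTheory GRing.Theory Num.Theory.
Import numFieldNormedType.Exports.
Local Open Scope classical_set_scope.
Local Open Scope ring_scope.

(** Put [p = 2 / (m - 1)], [A = 2 * p + N + 2], [B = (p + 2) * (p + N)] and
[h x = x `^ q - B * x `^ m], and write a profile as [f xi = xi `^ p * v xi].
With [w = - xi * (v `^ m)'], the equation becomes a system without explicit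
[xi] in the time [- ln xi] before the interface:
[[
  xi * v' = - w / (m * v `^ (m - 1)),
  xi * w' = (beta - m * A * v `^ (m - 1)) * w / (m * v `^ (m - 1)) - h v.
]]
Its equilibrium [v = c], [w = 0], where [c] is the positive zero of [h], is the
behaviour [f xi ~ c * xi `^ p] at the origin, and the interface is the point
[v = 0], [w = 0].  So a profile is a trajectory joining the two.

Existence.  The trajectory is sought as a curve [w = W v] over [0 < x < c], that
is, as a positive solution of
[[
  W' = m * A * x `^ (m - 1) - beta + m * x `^ (m - 1) * h x / W
]]
vanishing at 0 and at [c].  If [beta] is large, [h] is a supersolution, and
[kappa * x `^ (m - 1) * h x] is a subsolution for a small [kappa]; this is where
[m + q > 2] enters, since it makes the derivative of the latter function, of
order [x `^ (m + q - 2)], bounded.  Both vanish at 0 and at [c], so a solution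
between them will do ([phase_curve]), and it is obtained by Perron's method
([ode_solution_between]).  The time [S x] needed to go from [x] to the interface
has derivative [m * x `^ (m - 1) / W x]; the two barriers show that it is finite
at 0 and infinite at [c] ([phase_clock]).  Hence [S (v xi) = - ln xi] defines [v]
on exactly [0 < xi < 1], with limits [c] at 0 and 0 at 1 ([clock_inverse]), and
extending [xi `^ p * v xi] by 0 gives a profile ([is_profile_of_emden]).

Uniqueness ([emden_unique]).  Let [u] and [w] come from any profile.  As long as
[u < c], the distance [D = w - W u] to the curve satisfies
[xi * D' = h u / W u * D], whose coefficient is positive, so that [D ^+ 2] is
nondecreasing in [xi].  The interface condition says that it tends to 0 at
[xi = 1]; hence [D = 0].  Then [S u = - ln xi] as well, that is, [u = v].  In
particular [u] stays away from [c] on compact subsets of [0 < xi <= 1], so that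
the assumption [u < c] never fails. *)

(** * Derivatives, antiderivatives and powers *)

Lemma is_derive1_continuous (R : realType) (f : R -> R) (x d : R) :
  is_derive x 1 f d -> {for x, continuous f}.
Proof. by case=> df _; exact/differentiable_continuous/derivable1_diffP. Qed.

Lemma is_derive1_ext (R : realType) (f g : R -> R) (a b x d : R) :
  (forall y, a < y < b -> f y = g y) -> a < x < b ->
  is_derive x 1 f d -> is_derive x 1 g d.
Proof.
move=> fg xab; apply: near_eq_is_derive.
near=> y; apply: fg; near: y.
exact: (near_in_itvoo xab).
Unshelve. all: by end_near. Qed.

Lemma derive1_ge0_homo (R : realType) (a b : R) (f df : R -> R) :
  (forall x, a < x < b -> is_derive x 1 f (df x)) ->
  (forall x, a < x < b -> 0 <= df x) ->
  forall x y, a < x -> x <= y -> y < b -> f x <= f y.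
Proof.
move=> fdf df0 x y ax xy yb.
have inab z : x <= z <= y -> a < z < b.
  by case/andP=> xz zy; rewrite (lt_le_trans ax xz) (le_lt_trans zy yb).
have dfxy z : z \in `]x, y[ -> is_derive z 1 f (df z).
  by rewrite in_itv/= => /andP[/ltW xz /ltW zy]; apply/fdf/inab; rewrite xz.
have cf : {within `[x, y], continuous f}.
  apply: continuous_in_subspaceT => z /set_mem/=; rewrite in_itv/= => xzy.
  exact: is_derive1_continuous (fdf _ (inab _ xzy)).
have [z] := MVT_segment xy dfxy cf.
rewrite in_itv/= => xzy fxy; rewrite -subr_ge0 fxy mulr_ge0 ?subr_ge0//.
exact/df0/inab.
Qed.

Lemma derive1_0_cst (R : realType) (a b : R) (f : R -> R) :
  (forall x, a < x < b -> is_derive x 1 f 0) ->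
  forall x y, a < x < b -> a < y < b -> f x = f y.
Proof.
move=> f0 x y; wlog xy : x y / x <= y => [hw|].
  by case: (leP x y) => [xy|/ltW yx] xab yab; [|symmetry]; apply: hw.
move=> /andP[ax _] /andP[_ yb]; apply/eqP; rewrite eq_le.
have mono (g : R -> R) : (forall z, a < z < b -> is_derive z 1 g 0) -> g x <= g y.
  by move=> g0; apply: (@derive1_ge0_homo R a b g (fun=> 0)).
rewrite mono//= -lerN2; apply: (mono (- f)) => z /f0 fz.
by rewrite -oppr0; apply: is_deriveN.
Qed.

Lemma derive1_gt0_homo (R : realType) (a b : R) (f df : R -> R) :
  (forall x, a < x < b -> is_derive x 1 f (df x)) ->
  (forall x, a < x < b -> 0 < df x) ->
  forall x y, a < x -> x < y -> y < b -> f x < f y.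
Proof.
move=> fdf df0 x y ax xy yb.
have inab z : x <= z <= y -> a < z < b.
  by case/andP=> xz zy; rewrite (lt_le_trans ax xz) (le_lt_trans zy yb).
have inab' z : z \in `]x, y[ -> a < z < b.
  by rewrite in_itv/= => /andP[/ltW xz /ltW zy]; apply/inab; rewrite xz.
have cf : {within `[x, y], continuous f}.
  apply: continuous_in_subspaceT => z /set_mem/=; rewrite in_itv/= => xzy.
  exact: is_derive1_continuous (fdf _ (inab _ xzy)).
have [z /inab' zab fxy] := MVT xy (fun z zxy => fdf z (inab' z zxy)) cf.
by rewrite -subr_gt0 fxy mulr_gt0 ?subr_gt0// df0.
Qed.

Lemma is_derive1M (R : realType) (f g : R -> R) (x df dg : R) :
  is_derive x 1 f df -> is_derive x 1 g dg ->
  is_derive x 1 (fun t => f t * g t) (df * g x + f x * dg).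
Proof.
move=> hf hg; apply: (is_derive_eq (is_deriveM hf hg)).
by rewrite addrC; congr (_ + _); rewrite mulrC.
Qed.

Lemma is_derive1V (R : realType) (f : R -> R) (x df : R) :
  f x != 0 -> is_derive x 1 f df ->
  is_derive x 1 (fun t => (f t)^-1) (- df / f x ^+ 2).
Proof.
move=> f0 hf; apply: (is_derive_eq (is_deriveV f0 hf)).
by rewrite /GRing.scale/= mulrC mulrN mulNr.
Qed.

Lemma is_derive_integral (R : realType) (a b u x : R) (f : R -> R) :
  (forall x, a < x < b -> {for x, continuous f}) -> a < u -> u < x -> x < b ->
  is_derive x 1
    (fun y => (\int[lebesgue_measure]_(t in `[u, y]) f t)%R) (f x).
Proof.
move=> cf au ux xb.
have vb : (x + b) / 2 < b by lra.
have xv : x < (x + b) / 2 by lra.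
have [//||] := @continuous_FTC1_closed R f u x ((x + b) / 2) xv _ ux.
- apply: continuous_compact_integrable; first exact: segment_compact.
  apply: continuous_in_subspaceT => z /set_mem/=; rewrite in_itv/= => /andP[uz zv].
  by apply: cf; rewrite (lt_le_trans au uz) (le_lt_trans zv vb).
- by apply: cf; rewrite (lt_trans au ux).
- by move=> dF F'; apply: (DeriveDef dF); rewrite -derive1E; exact: F'.
Qed.

(** The integral starts at a point [u x] to the left of both [x] and the midpoint
[c], which avoids oriented integrals; the difference of the integrals up to [x]
and up to [c] does not depend on this point. *)
Lemma antiderivative_itvoo (R : realType) (a b : R) (f : R -> R) :
  (forall x, a < x < b -> {for x, continuous f}) ->
  exists P : R -> R, forall x, a < x < b -> is_derive x 1 P (f x).
Proof.
move=> cf; have [ab|ba] := ltP a b; last first.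
  by exists f => x /andP[ax /(lt_trans ax)]; rewrite ltNge ba.
pose Q u x : R := (\int[lebesgue_measure]_(t in `[u, x]) f t)%R.
pose c := (a + b) / 2.
pose u x := (a + Num.min x c) / 2.
have acb : a < c < b by rewrite /c; lra.
have QQ u1 u2 x : a < u1 -> u1 <= u2 -> u2 < x -> x < b -> u2 < c ->
    Q u2 x - Q u2 c = Q u1 x - Q u1 c.
  move=> au1 u12 u2x xb u2c.
  suff : Q u2 x - Q u1 x = Q u2 c - Q u1 c by lra.
  apply: (@derive1_0_cst R u2 b (Q u2 - Q u1)); last 2 first.
  - by rewrite u2x.
  - by rewrite u2c; lra.
  move=> z /andP[u2z zb]; rewrite -(subrr (f z)).
  by apply: is_deriveB; apply: (@is_derive_integral R a b) => //; lra.
exists (fun x => Q (u x) x - Q (u x) c) => x /andP[ax xb].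
have minx y : Num.min y c <= y by rewrite ge_min lexx.
have minc y : Num.min y c <= c by rewrite ge_min lexx orbT.
have amin y : a < y -> a < Num.min y c by rewrite lt_min => ->; case/andP: acb.
pose u1 := (a + u x) / 2.
have au1 : a < u1 by rewrite /u1 /u; have := amin _ ax; lra.
have u1x : u1 < x by rewrite /u1 /u; have := minx x; have := amin _ ax; lra.
have u1c : u1 < c by rewrite /u1 /u; have := minc x; have := amin _ ax; lra.
apply: (@near_eq_is_derive _ _ _ (fun y => Q u1 y - Q u1 c)); last first.
  rewrite -[f x]subr0; apply: is_deriveB; exact: (@is_derive_integral R a b).
have xin : (2 * u1 - a) < x < b.
  by rewrite xb andbT /u1 /u; have := minx x; have := amin _ ax; lra.
near=> y.
have /andP[yu yb] : 2 * u1 - a < y < b by near: y; exact: (near_in_itvoo xin).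
have ay : a < y by lra.
symmetry; apply: QQ => //.
- rewrite /u; have : 2 * u1 - a <= Num.min y c.
    by rewrite le_min (ltW yu)/= /u1 /u; have := minc x; lra.
  by lra.
- by rewrite /u; have := minx y; lra.
- by rewrite /u; have := minc y; have := amin _ ay; lra.
Unshelve. all: by end_near. Qed.

Lemma cvg_near_eq (R : realType) (F : set_system R) {FF : Filter F}
    (P : set R) (f g : R -> R) (l : R) :
  (\forall t \near F, P t) -> (forall t, P t -> f t = g t) ->
  g t @[t --> F] --> l -> f t @[t --> F] --> l.
Proof.
move=> nP fg; apply: cvg_trans; apply: near_eq_cvg.
by apply: filterS nP => t Pt; rewrite fg.
Qed.

Lemma gt0_powRD (R : realType) (x p r : R) : 0 < x ->
  x `^ (p + r) = x `^ p * x `^ r.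
Proof. by move=> x0; rewrite powRD// (gt_eqF x0) implybT. Qed.

Lemma continuous_powR (R : realType) (p x : R) : 0 < x ->
  {for x, continuous (fun t : R => t `^ p)}.
Proof.
by move=> x0; apply: (@is_derive1_continuous _ _ _ _ (is_derive1_powR p x0)).
Qed.

Lemma cvg_powR0 (R : realType) (F : set_system R) {FF : Filter F}
    (u : R -> R) (r : R) :
  0 < r -> (\forall t \near F, 0 <= u t) -> u t @[t --> F] --> 0 ->
  u t `^ r @[t --> F] --> 0.
Proof.
move=> r0 u0 u_to0; apply/cvgrPdist_lt => e e0.
have d0 : 0 < e `^ r^-1 by exact: powR_gt0.
move/cvgrPdist_lt : u_to0 => /(_ _ d0) ud; near=> t.
have : `|0 - u t| < e `^ r^-1 by near: t.
have ut0 : 0 <= u t by near: t.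
rewrite !sub0r !normrN !ger0_norm ?powR_ge0// => utd.
rewrite -[ltRHS]powRr1 ?ltW// -(mulVf (lt0r_neq0 r0)) powRrM.
by apply: gt0_ltr_powR; rewrite ?nnegrE ?powR_ge0.
Unshelve. all: by end_near. Qed.

(** * Solutions of a first-order equation between two barriers *)

Lemma continuous_increment_between (R : realType) (a b x : R) (f g w : R -> R) :
  (forall y z, a < y -> y <= z -> z < b -> f z - f y <= w z - w y <= g z - g y) ->
  a < x < b -> {for x, continuous f} -> {for x, continuous g} ->
  {for x, continuous w}.
Proof.
move=> fwg /[dup] xab /andP[ax xb] cf cg; apply/cvgrPdist_lt => e e0.
near=> y.
have /andP[ay yb] : a < y < b by near: y; exact: (near_in_itvoo xab).
have fe : `|f x - f y| < e by near: y; move/cvgrPdist_lt : cf; exact.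
have ge : `|g x - g y| < e by near: y; move/cvgrPdist_lt : cg; exact.
rewrite !ltr_norml in fe ge *.
have [xy|/ltW yx] := leP x y; first by have := fwg _ _ ax xy yb; lra.
by have := fwg _ _ ay yx xb; lra.
Unshelve. all: by end_near. Qed.

(** Perron's method, in the form of the Knaster-Tarski theorem: [T v] is the
antiderivative of [x |-> F x (v x)] that starts from [lo] at the left end, an
increasing operator on the functions between [lo] and [up], and the supremum of
the functions [v <= T v] is a fixed point.  Only functions whose increments lie
between those of two fixed antiderivatives are admitted; this is preserved by
pointwise suprema and makes them continuous. *)
Lemma ode_solution_between_homo (R : realType) (a b : R) (F : R -> R -> R)
    (lo dlo up dup : R -> R) :
  (forall x, a < x < b -> is_derive x 1 lo (dlo x)) ->
  (forall x, a < x < b -> is_derive x 1 up (dup x)) ->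
  (forall x, a < x < b -> dlo x <= F x (lo x)) ->
  (forall x, a < x < b -> F x (up x) <= dup x) ->
  (forall x, a < x < b -> lo x <= up x) ->
  (forall v : R -> R, (forall x, a < x < b -> {for x, continuous v}) ->
     (forall x, a < x < b -> lo x <= v x <= up x) ->
     forall x, a < x < b -> {for x, continuous (fun t => F t (v t))}) ->
  (forall x y z, a < x < b -> lo x <= y -> y <= z -> z <= up x ->
     F x y <= F x z) ->
  exists w : R -> R, forall x, a < x < b ->
    lo x <= w x <= up x /\ is_derive x 1 w (F x (w x)).
Proof.
move=> hlo hup dloF Fdup loup cF mF.
pose adm (v : R -> R) := (forall x, a < x < b -> {for x, continuous v}) /\
  (forall x, a < x < b -> lo x <= v x <= up x).
have /choice[P hP] (v : R -> R) : exists p : R -> R, adm v ->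
    forall x, a < x < b -> is_derive x 1 p (F x (v x)).
  have [av|nav] := pselect (adm v); last by exists v.
  have [p hp] := antiderivative_itvoo _ a b _ (cF v av.1 av.2).
  by exists p.
have monoP v1 v2 : adm v1 -> adm v2 ->
    (forall x, a < x < b -> v1 x <= v2 x) ->
    forall y z, a < y -> y <= z -> z < b -> P v1 z - P v1 y <= P v2 z - P v2 y.
  move=> a1 a2 v12 y z ay yz zb.
  suff : (P v2 - P v1) y <= (P v2 - P v1) z by rewrite !fctE; lra.
  apply: (@derive1_ge0_homo R a b _ (fun x => F x (v2 x) - F x (v1 x))) => // x xab.
    by apply: is_deriveB; exact: hP.
  have /andP[? ?] := a1.2 _ xab; have /andP[? ?] := a2.2 _ xab.
  by rewrite subr_ge0; apply: mF => //; exact: v12.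
have Plo v : adm v -> forall y z, a < y -> y <= z -> z < b ->
    P v y - lo y <= P v z - lo z.
  move=> av; apply: (@derive1_ge0_homo R a b _ (fun x => F x (v x) - dlo x)) => x xab.
    by apply: is_deriveB; [exact: hP|exact: hlo].
  have /andP[? ?] := av.2 _ xab.
  by rewrite subr_ge0; apply: le_trans (dloF _ xab) (mF _ _ _ _ _ _ _).
have Pup v : adm v -> forall y z, a < y -> y <= z -> z < b ->
    up y - P v y <= up z - P v z.
  move=> av; apply: (@derive1_ge0_homo R a b _ (fun x => dup x - F x (v x))) => x xab.
    by apply: is_deriveB; [exact: hup|exact: hP].
  have /andP[? ?] := av.2 _ xab.
  by rewrite subr_ge0; apply: le_trans (Fdup _ xab); apply: mF.
(* [P v - lo] is nondecreasing and [P v - up] nonincreasing, so that the infimum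
   of the former, its limit at the left end, is finite. *)
have lbP v : adm v -> forall x z, a < x < b -> a < z < b ->
    P v x - up x <= P v z - lo z.
  move=> av x z /andP[ax xb] /andP[az zb].
  have [xz|/ltW zx] := leP x z.
    have := Plo v av _ _ ax xz zb; have := loup x; rewrite ax xb => /(_ isT); lra.
  have := Pup v av _ _ az zx xb; have := loup z; rewrite az zb => /(_ isT); lra.
pose E v := [set P v z - lo z | z in [set z | a < z < b]].
pose T v x := P v x - inf (E v).
have infE v : adm v -> forall z, a < z < b -> inf (E v) <= P v z - lo z.
  move=> av z zab; apply: ge_inf; last by exists z.
  by exists (P v z - up z) => _ [t tab <-]; exact: lbP.
have Einf v r x : a < x < b ->
    (forall z, a < z < b -> r <= P v z - lo z) -> r <= inf (E v).
  move=> xab h; apply: lb_le_inf; first by exists (P v x - lo x); exists x.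
  by move=> _ [z zab <-]; exact: h.
have TF v : adm v -> forall x, a < x < b -> is_derive x 1 (T v) (F x (v x)).
  move=> av x xab; rewrite -[F _ _]subr0.
  by apply: is_deriveB; exact: hP.
have Tadm v : adm v -> adm (T v).
  move=> av; split => x xab; first exact: is_derive1_continuous (TF _ av _ xab).
  rewrite /T; have := infE v av x xab.
  have := Einf v (P v x - up x) x xab (fun z => lbP v av x z xab).
  lra.
have Tmono v1 v2 : adm v1 -> adm v2 ->
    (forall x, a < x < b -> v1 x <= v2 x) ->
    forall x, a < x < b -> T v1 x <= T v2 x.
  move=> a1 a2 v12 x xab; rewrite /T.
  suff : inf (E v2) - P v2 x + P v1 x <= inf (E v1) by lra.
  apply: (Einf v1 _ x xab) => z zab.
  have /andP[ax xb] := xab; have /andP[az zb] := zab.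
  have [zx|/ltW xz] := leP z x.
    by have := infE v2 a2 z zab; have := monoP v1 v2 a1 a2 v12 z x az zx xb; lra.
  by have := infE v2 a2 x xab; have := Plo v1 a1 x z ax xz zb; lra.
have admlo : adm lo.
  by split=> x xab; [exact: is_derive1_continuous (hlo _ xab)|rewrite lexx loup].
have admup : adm up.
  by split=> x xab; [exact: is_derive1_continuous (hup _ xab)|rewrite lexx loup].
pose incr (v : R -> R) := forall y z, a < y -> y <= z -> z < b ->
  P lo z - P lo y <= v z - v y <= P up z - P up y.
have Tincr v : adm v -> incr (T v).
  move=> av y z ay yz zb; rewrite /T.
  have := monoP lo v admlo av (fun x xab => (andP (av.2 x xab)).1) y z ay yz zb.
  have := monoP v up av admup (fun x xab => (andP (av.2 x xab)).2) y z ay yz zb.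
  by lra.
pose S v := [/\ adm v, incr v & forall x, a < x < b -> v x <= T v x].
have STlo : S (T lo).
  split; [exact: Tadm|exact: Tincr|apply: Tmono => //; first exact: Tadm].
  by move=> x xab; case: (Tadm lo admlo) => _ /(_ _ xab) /andP[].
pose w x := sup [set v x | v in S].
have Sw v x : a < x < b -> S v -> v x <= w x.
  move=> xab Sv; apply: ub_le_sup; last by exists v.
  by exists (up x) => _ [u [[_ +] _ _] <-] => /(_ _ xab) /andP[].
have wS r x : (forall v, S v -> v x <= r) -> w x <= r.
  move=> h; apply: ge_sup; first by exists (T lo x); exists (T lo).
  by move=> _ [v Sv <-]; exact: h.
have wincr : incr w.
  move=> y z ay yz zb.
  have yab : a < y < b by rewrite ay (le_lt_trans yz).
  have zab : a < z < b by rewrite zb (lt_le_trans ay).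
  have h1 : w y <= w z - (P lo z - P lo y).
    apply: wS => v Sv; have := Sw v z zab Sv; case: Sv => _ /(_ y z ay yz zb).
    by lra.
  have h2 : w z <= w y + (P up z - P up y).
    apply: wS => v Sv; have := Sw v y yab Sv; case: Sv => _ /(_ y z ay yz zb).
    by lra.
  by lra.
have admw : adm w.
  split=> x xab.
    by apply: (@continuous_increment_between R a b x (P lo) (P up)) => //;
      [exact: is_derive1_continuous (hP _ admlo _ xab)
      |exact: is_derive1_continuous (hP _ admup _ xab)].
  apply/andP; split.
    apply: le_trans (Sw _ _ xab STlo).
    by case: (Tadm lo admlo) => _ /(_ _ xab) /andP[].
  by apply: wS => v [[_ +] _ _] => /(_ _ xab) /andP[].
have wTw x : a < x < b -> w x <= T w x.
  move=> xab; apply: wS => v Sv; have [av _ vT] := Sv.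
  by apply: le_trans (vT _ xab) _; apply: Tmono => // z zab; exact: Sw.
have STw : S (T w).
  by split; [exact: Tadm|exact: Tincr|apply: Tmono => //; exact: Tadm].
have Tww x : a < x < b -> T w x = w x.
  by move=> xab; apply/eqP; rewrite eq_le wTw ?Sw.
exists w => x xab; split; first by case: admw => _; exact.
by apply: (is_derive1_ext _ _ _ a b _ _ Tww xab); exact: TF.
Qed.

(** An integrating factor [expR L] with [L^`() = l] turns [w' = F x w] into an
equation with right-hand side increasing in the unknown. *)
Lemma ode_solution_between (R : realType) (a b : R) (F : R -> R -> R)
    (l lo dlo up dup : R -> R) :
  (forall x, a < x < b -> is_derive x 1 lo (dlo x)) ->
  (forall x, a < x < b -> is_derive x 1 up (dup x)) ->
  (forall x, a < x < b -> dlo x <= F x (lo x)) ->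
  (forall x, a < x < b -> F x (up x) <= dup x) ->
  (forall x, a < x < b -> lo x <= up x) ->
  (forall v : R -> R, (forall x, a < x < b -> {for x, continuous v}) ->
     (forall x, a < x < b -> lo x <= v x <= up x) ->
     forall x, a < x < b -> {for x, continuous (fun t => F t (v t))}) ->
  (forall x, a < x < b -> {for x, continuous l}) ->
  (forall x y z, a < x < b -> lo x <= y -> y <= z -> z <= up x ->
     F x y + l x * y <= F x z + l x * z) ->
  exists w : R -> R, forall x, a < x < b ->
    lo x <= w x <= up x /\ is_derive x 1 w (F x (w x)).
Proof.
move=> hlo hup dloF Fdup loup cF cl mF.
have [L hL] := antiderivative_itvoo _ a b _ cl.
pose E x := expR (L x).
have E0 x : 0 < E x by exact: expR_gt0.
have En x : E x != 0 by rewrite gt_eqF.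
have hE x : a < x < b -> is_derive x 1 E (E x * l x).
  by move=> xab; apply: is_derive1_comp; exact: hL.
have cE x : a < x < b -> {for x, continuous E}.
  by move=> /hE; exact: is_derive1_continuous.
have cEV x : a < x < b -> {for x, continuous (fun t => (E t)^-1)}.
  by move=> xab; apply: continuousV; [exact: En|exact: cE].
pose H x V := E x * (F x (V / E x) + l x * (V / E x)).
have toF x (v V : R) : V = E x * v -> H x V = E x * (F x v + l x * v).
  by move=> ->; rewrite /H mulrAC divff ?mul1r.
have [|||||||V hV] := @ode_solution_between_homo R a b H
  (fun x => E x * lo x) (fun x => E x * l x * lo x + E x * dlo x)
  (fun x => E x * up x) (fun x => E x * l x * up x + E x * dup x).
- by move=> x xab; apply: is_derive1M; [exact: hE|exact: hlo].
- by move=> x xab; apply: is_derive1M; [exact: hE|exact: hup].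
- move=> x xab; rewrite (toF x (lo x))// mulrDr addrC mulrA lerD2r.
  by rewrite ler_pM2l// dloF.
- move=> x xab; rewrite (toF x (up x))// mulrDr [leRHS]addrC mulrA lerD2r.
  by rewrite ler_pM2l// Fdup.
- by move=> x xab; rewrite ler_pM2l// loup.
- move=> v cv hv x xab.
  have cvE z : a < z < b -> {for z, continuous (fun t => v t / E t)}.
    by move=> zab; apply: continuousM; [exact: cv|exact: cEV].
  have vE z : a < z < b -> lo z <= v z / E z <= up z.
    by move=> zab; rewrite ler_pdivlMr// ler_pdivrMr// ![_ * E z]mulrC hv.
  apply: continuousM; first exact: cE.
  apply: continuousD; first exact: cF.
  by apply: continuousM; [exact: cl|exact: cvE].
- move=> x y z xab; rewrite -ler_pdivlMl// -[z <= _]ler_pdivrMl//.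
  rewrite ![(E x)^-1 * _]mulrC => ly yz zu.
  by rewrite /H ler_pM2l//; apply: mF => //; rewrite ler_pM2r ?invr_gt0.
exists (fun x => V x / E x) => x xab; have [/andP[lV Vu] dV] := hV x xab.
split; first by rewrite ler_pdivlMr// ler_pdivrMr// ![_ * E x]mulrC lV.
have dE := is_derive1V _ _ _ _ (En x) (hE _ xab).
apply: (is_derive_eq (is_derive1M _ _ _ _ _ _ dV dE)).
by rewrite /H; move: (En x); move: (E x) => e e0; field.
Qed.

(** * The phase curve *)

(** The function written [h] in the comments: the absorption minus the term of
order zero that the diffusion produces in the variable [v]. *)
Definition excess (R : realType) (m q B x : R) : R := x `^ q - B * x `^ m.
Arguments excess {R} m q B x.

Lemma excess_gt0 (R : realType) (m q B c x : R) :
  q < m -> B * c `^ (m - q) = 1 -> 0 < x -> x < c -> 0 < excess m q B x.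
Proof.
move=> qm Bc x0 xc; have c0 := lt_trans x0 xc.
have B0 : 0 < B by rewrite -(@pmulr_lgt0 _ (c `^ (m - q))) ?powR_gt0// Bc.
have -> : excess m q B x = x `^ q * (1 - B * x `^ (m - q)).
  rewrite /excess mulrBr mulr1 mulrCA -gt0_powRD//.
  by rewrite [q + _]addrC subrK.
rewrite mulr_gt0 ?powR_gt0// subr_gt0 -Bc ltr_pM2l//.
by apply: gt0_ltr_powR => //; rewrite ?subr_gt0// nnegrE ltW.
Qed.

Lemma is_derive_excess (R : realType) (m q B x : R) : 0 < x ->
  is_derive x 1 (excess m q B) (q * x `^ (q - 1) - B * (m * x `^ (m - 1))).
Proof.
move=> x0; apply: is_deriveB; first exact: is_derive1_powR.
have dm := is_deriveZ B (is_derive1_powR m x0).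
exact: dm.
Qed.

Lemma continuous_excess (R : realType) (m q B x : R) : 0 < x ->
  {for x, continuous (excess m q B)}.
Proof. by move=> x0; exact: (is_derive1_continuous _ _ _ _ (is_derive_excess _ m q B x x0)). Qed.

(** The barriers are [h] and [lo = kappa * x `^ (m - 1) * h].  For the upper one
the quotient [h / W] is 1 and [h' >= - m * B * x `^ (m - 1)], so that
[beta >= m * (A + B + 1) * c `^ (m - 1)] suffices.  For the lower one the last
term of the equation is the constant [m / kappa = beta + M], where [M] is an
upper bound of the derivative of [x `^ (m - 1) * h], so that
[lo' <= kappa * M <= M]; the summand [m] of the bound on [beta] is there to have
[kappa <= 1].  Above [lo] the right-hand
side decreases in [W] with slope at least [- m * x `^ (m - 1) * h x / lo x ^+ 2],
which gives the integrating factor. *)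
Lemma phase_curve (R : realType) (m q A B c beta : R) :
  1 < m -> 0 < q -> q < 1 -> 2 < m + q -> 0 <= A -> 0 < B -> 0 < c ->
  B * c `^ (m - q) = 1 ->
  m * (A + B + 1) * c `^ (m - 1) + m <= beta ->
  exists2 kappa : R, 0 < kappa & exists W : R -> R,
    forall x, 0 < x < c ->
      kappa * (x `^ (m - 1) * excess m q B x) <= W x <= excess m q B x /\
      is_derive x 1 W (m * A * x `^ (m - 1) - beta
        + m * x `^ (m - 1) * excess m q B x / W x).
Proof.
move=> m1 q0 q1 mq A0 B0 c0 Bc hbeta.
set h := excess m q B.
have hgt0 x : 0 < x < c -> 0 < h x.
  by case/andP=> x0 xc; apply: (@excess_gt0 R m q B c) => //; lra.
have cm0 : 0 < c `^ (m - 1) by exact: powR_gt0.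
pose M := (m + q - 1) * c `^ (m + q - 2).
have M0 : 0 < M by rewrite mulr_gt0 ?powR_gt0//; lra.
have mbeta : m <= beta.
  apply: le_trans hbeta; rewrite lerDr !mulr_ge0 ?ltW//; lra.
pose kappa := m / (beta + M).
have kappa0 : 0 < kappa by rewrite divr_gt0//; lra.
have kappa1 : kappa <= 1 by rewrite ler_pdivrMr; lra.
have mk : m / kappa = beta + M by rewrite /kappa; field; lra.
have kc : kappa * c `^ (m - 1) <= 1.
  rewrite mulrAC ler_pdivrMr; last lra.
  rewrite mul1r; apply: le_trans (_ : beta <= _); last lra.
  apply: le_trans hbeta.
  have : 0 <= m * (A + B) * c `^ (m - 1) by rewrite !mulr_ge0//; lra.
  lra.
have powle p x : 0 <= p -> 0 < x < c -> x `^ p <= c `^ p.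
  by move=> p0 /andP[x0 xc]; apply: ge0_ler_powR; rewrite // ?nnegrE ltW.
pose lo x := kappa * (x `^ (m - 1) * h x).
have lo0 x : 0 < x < c -> 0 < lo x.
  by move=> xc; rewrite mulr_gt0// mulr_gt0 ?hgt0// powR_gt0//; case/andP: xc.
pose F x w := m * A * x `^ (m - 1) - beta + m * x `^ (m - 1) * h x / w.
have cpow p x : 0 < x < c -> {for x, continuous (fun t : R => t `^ p)}.
  by case/andP=> + _; exact: continuous_powR.
have ch x : 0 < x < c -> {for x, continuous h}.
  by case/andP=> + _; exact: continuous_excess.
have clo x : 0 < x < c -> {for x, continuous lo}.
  move=> xc; apply: continuousM; first exact: cvg_cst.
  by apply: continuousM; [exact: cpow|exact: ch].
have ck x : 0 < x < c -> {for x, continuous (fun t => m * t `^ (m - 1) * h t)}.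
  move=> xc; apply: continuousM; last exact: ch.
  by apply: continuousM; [exact: cvg_cst|exact: cpow].
have [||||||||W hW] := @ode_solution_between R 0 c F
  (fun x => m * x `^ (m - 1) * h x / (lo x * lo x))
  lo (fun x => kappa * (((m - 1) * x `^ (m - 1 - 1)) * h x
     + x `^ (m - 1) * (q * x `^ (q - 1) - B * (m * x `^ (m - 1)))))
  h (fun x => q * x `^ (q - 1) - B * (m * x `^ (m - 1))).
- move=> x /andP[x0 xc].
  have dm := is_derive1M _ _ _ _ _ _ (is_derive1_powR (m - 1) x0)
    (is_derive_excess _ m q B x x0).
  exact: (is_deriveZ kappa dm).
- by move=> x /andP[x0 xc]; exact: is_derive_excess.
- move=> x xc; have x0 : 0 < x by case/andP: xc.
  have -> : F x (lo x) = m * A * x `^ (m - 1) + M.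
    have e : m * x `^ (m - 1) * h x / lo x = m / kappa.
      have h0 := hgt0 _ xc; rewrite /lo; field.
      by rewrite !gt_eqF ?powR_gt0.
    by rewrite /F e mk; lra.
  apply: le_trans (_ : kappa * M <= _); last first.
    have : 0 <= m * A * x `^ (m - 1) by rewrite !mulr_ge0 ?powR_ge0//; lra.
    have : kappa * M <= 1 * M by rewrite ler_pM2r.
    by lra.
  rewrite ler_pM2l//.
  apply: le_trans (_ : (m + q - 1) * x `^ (m + q - 2) <= _); last first.
    by rewrite ler_pM2l; [apply: powle => //; lra|lra].
  have e1 : x `^ (m - 1 - 1) * x `^ q = x `^ (m + q - 2).
    by rewrite -gt0_powRD//; congr (_ `^ _); lra.
  have e2 : x `^ (m - 1) * x `^ (q - 1) = x `^ (m + q - 2).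
    by rewrite -gt0_powRD//; congr (_ `^ _); lra.
  have p1 : 0 <= (m - 1) * (x `^ (m - 1 - 1) * (B * x `^ m)).
    by rewrite !mulr_ge0 ?powR_ge0 ?ltW//; lra.
  have p2 : 0 <= x `^ (m - 1) * (B * (m * x `^ (m - 1))).
    by rewrite !mulr_ge0 ?powR_ge0 ?ltW//; lra.
  rewrite /h /excess mulrBr mulrBr -![(m - 1) * _ * _]mulrA e1.
  rewrite [x `^ (m - 1) * (q * _)]mulrCA e2.
  by lra.
- move=> x xc; have x0 : 0 < x by case/andP: xc.
  rewrite /F mulfK ?gt_eqF ?hgt0//.
  have p1 : 0 <= q * x `^ (q - 1) by rewrite mulr_ge0 ?powR_ge0 ?ltW.
  have p2 : m * (A + B + 1) * x `^ (m - 1) <= m * (A + B + 1) * c `^ (m - 1).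
    by rewrite ler_wpM2l ?powle// ?mulr_ge0//; lra.
  by lra.
- move=> x xc; rewrite /lo mulrA -[leRHS]mul1r ler_pM2r ?hgt0//.
  by apply: le_trans kc; rewrite ler_pM2l// powle//; lra.
- move=> v cv hv x xc.
  have v0 : v x != 0.
    by rewrite gt_eqF//; apply: lt_le_trans (lo0 _ xc) _; case/andP: (hv _ xc).
  apply: continuousD.
    apply: continuousD; last exact: cvg_cst.
    by apply: continuousM; [exact: cvg_cst|exact: cpow].
  apply: continuousM; first exact: ck.
  by apply: continuousV => //; exact: cv.
- move=> x xc; apply: continuousM; first exact: ck.
  apply: continuousV; first by rewrite mulf_neq0 ?gt_eqF ?lo0.
  by apply: continuousM; exact: clo.
- move=> x y z xc ly yz _; rewrite /F.
  have l0 := lo0 _ xc; have y0 := lt_le_trans l0 ly; have z0 := lt_le_trans y0 yz.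
  have k0 : 0 <= m * x `^ (m - 1) * h x.
    by rewrite !mulr_ge0 ?powR_ge0 ?(ltW (hgt0 _ xc))//; lra.
  move: (m * x `^ (m - 1) * h x) k0 => k k0.
  suff : k / y - k / z <= k / (lo x * lo x) * (z - y) by lra.
  have -> : k / y - k / z = k / (y * z) * (z - y) by field; rewrite !gt_eqF.
  have yz0 : 0 < y * z by exact: mulr_gt0.
  have ll0 : 0 < lo x * lo x by exact: mulr_gt0.
  rewrite ler_wpM2r ?subr_ge0// ler_wpM2l// lef_pV2 ?posrE//.
  by rewrite ler_pM ?(ltW l0)// (le_trans ly).
by exists kappa => //; exists W.
Qed.

(** * The time along the phase curve *)

(** [S x] is the time from [x] to the interface at 0.  It is finite because [W] is
at least a multiple of [x `^ (m - 1 + q)] near 0 and [q < 1]; it is unbounded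
because [W <= h] and [h] vanishes linearly at [c]. *)
Lemma phase_clock (R : realType) (m q B c kappa : R) (W : R -> R) :
  1 < m -> 0 < q -> q < 1 -> 0 < c -> B * c `^ (m - q) = 1 -> 0 < kappa ->
  (forall x, 0 < x < c ->
     kappa * (x `^ (m - 1) * excess m q B x) <= W x <= excess m q B x) ->
  (forall x, 0 < x < c -> {for x, continuous W}) ->
  exists S : R -> R,
    [/\ forall x, 0 < x < c -> is_derive x 1 S (m * x `^ (m - 1) / W x),
        forall x, 0 < x < c -> 0 < S x,
        forall e, 0 < e -> exists2 x, 0 < x < c & S x < e &
        forall M, exists2 x, 0 < x < c & M < S x].
Proof.
move=> m1 q0 q1 c0 Bc kappa0 hW cW.
set h := excess m q B in hW.
have B0 : 0 < B by rewrite -(@pmulr_lgt0 _ (c `^ (m - q))) ?powR_gt0// Bc.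
have hgt0 x : 0 < x < c -> 0 < h x.
  by case/andP=> x0 xc; apply: (@excess_gt0 R m q B c) => //; lra.
have W0 x : 0 < x < c -> 0 < W x.
  move=> xc; apply: lt_le_trans (andP (hW x xc)).1.
  by rewrite mulr_gt0// mulr_gt0 ?hgt0// powR_gt0//; case/andP: xc.
have s0 x : 0 < x < c -> 0 < m * x `^ (m - 1) / W x.
  move=> xc; rewrite divr_gt0 ?W0// mulr_gt0 ?powR_gt0//; first lra.
  by case/andP: xc.
have cs x : 0 < x < c ->
    {for x, continuous (fun t : R => m * t `^ (m - 1) / W t)}.
  move=> xc; apply: continuousM; last first.
    by apply: continuousV; [rewrite gt_eqF// W0|exact: cW].
  apply: continuousM; first exact: cvg_cst.
  by apply: continuous_powR; case/andP: xc.
have [S0 dS0] := antiderivative_itvoo _ _ _ _ cs.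
have S0lt := derive1_gt0_homo _ _ _ _ _ dS0 s0.
pose y := c / 2; pose z := 3 * c / 4.
have yc : 0 < y < c by rewrite /y; lra.
have zc : 0 < z < c by rewrite /z; lra.
have yz : y < z by rewrite /y /z; lra.
(* to the left of [z] the clock runs slower than [C * x `^ (1 - q)] *)
pose d := kappa * (1 - B * z `^ (m - q)).
have d0 : 0 < d.
  rewrite mulr_gt0// subr_gt0 -Bc ltr_pM2l//.
  by apply: gt0_ltr_powR; rewrite ?subr_gt0 ?nnegrE; lra.
pose C := m / d / (1 - q).
have C0 : 0 < C by rewrite !divr_gt0//; lra.
have dC (x : R) : 0 < x ->
    is_derive x 1 (fun t : R => C * t `^ (1 - q)) (m / d * x `^ (- q)).
  move=> x0; apply: (is_derive_eq (is_deriveZ C (is_derive1_powR (1 - q) x0))).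
  rewrite /GRing.scale/= mulrA /C mulfVK; last by rewrite subr_eq0 gt_eqF.
  by congr (_ * (_ `^ _)); lra.
have sle (x : R) : 0 < x < z -> m * x `^ (m - 1) / W x <= m / d * x `^ (- q).
  move=> /andP[x0 xz]; have xc : 0 < x < c by rewrite x0; lra.
  have xm0 : 0 < x `^ (m - 1) by exact: powR_gt0.
  have xq0 : 0 < x `^ q by exact: powR_gt0.
  have dW : x `^ (m - 1) * x `^ q * d <= W x.
    apply: le_trans (andP (hW x xc)).1.
    rewrite /d mulrCA ler_pM2l// -mulrA ler_pM2l// /h /excess.
    have -> : x `^ m = x `^ (m - q) * x `^ q by rewrite -gt0_powRD// subrK.
    have : x `^ (m - q) <= z `^ (m - q).
      by apply: ge0_ler_powR; rewrite ?nnegrE; lra.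
    move: (x `^ (m - q)) (z `^ (m - q)) (x `^ q) xq0 => r1 r2 r3 r30 r12.
    have : 0 <= r3 * (B * (r2 - r1)) by rewrite !mulr_ge0 ?subr_ge0// ltW.
    by lra.
  rewrite ler_pdivrMr ?W0// powRN.
  have -> : m * x `^ (m - 1) = m / d / x `^ q * (x `^ (m - 1) * x `^ q * d).
    by field; rewrite !gt_eqF.
  by rewrite ler_pM2l// !divr_gt0//; lra.
have Sy (x : R) : 0 < x -> x < y -> S0 y - C * y `^ (1 - q) <= S0 x.
  move=> x0 xy.
  have : C * x `^ (1 - q) - S0 x <= C * y `^ (1 - q) - S0 y.
    apply: (@derive1_ge0_homo R 0 z (fun t : R => C * t `^ (1 - q) - S0 t)
      (fun t => m / d * t `^ (- q) - m * t `^ (m - 1) / W t)) => [t|t|||].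
    - move=> /andP[t0 tz]; apply: is_deriveB; first exact: dC.
      by apply: dS0; rewrite t0; lra.
    - by move=> tz; rewrite subr_ge0 sle.
    - exact: x0.
    - exact: ltW.
    - exact: yz.
  have : 0 <= C * x `^ (1 - q) by rewrite mulr_ge0 ?powR_ge0 ?ltW.
  by lra.
(* [h] is bounded by [K * (c - x)], so that the clock runs faster than
   [- k2 * ln (c - x)] to the right of [y] *)
pose K := B * (m * (2 * c) `^ (m - 1)).
have K0 : 0 < K by rewrite !mulr_gt0 ?powR_gt0//; lra.
have hK (x : R) : 0 < x < c -> h x <= K * (c - x).
  move=> /andP[x0 xc].
  have hc : h c = 0.
    rewrite /h /excess.
    have -> : c `^ m = c `^ (m - q) * c `^ q by rewrite -gt0_powRD// subrK.
    by rewrite mulrA Bc mul1r subrr.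
  have : h x + K * x <= h c + K * c.
    apply: (@derive1_ge0_homo R 0 (2 * c) (fun t : R => h t + K * t)
      (fun t => q * t `^ (q - 1) - B * (m * t `^ (m - 1)) + K)) => // [t|t||].
    - move=> /andP[t0 _]; apply: is_deriveD; first exact: is_derive_excess.
      apply: (is_derive_eq (is_deriveZ K (is_derive_id t 1))).
      by rewrite /GRing.scale/= mulr1.
    - move=> /andP[t0 tc].
      have : 0 <= q * t `^ (q - 1) by rewrite mulr_ge0 ?powR_ge0 ?ltW.
      have : B * (m * t `^ (m - 1)) <= K.
        rewrite ler_pM2l// ler_pM2l; last lra.
        by apply: ge0_ler_powR; rewrite ?nnegrE; lra.
      by lra.
    - exact: ltW.
    - by lra.
  by rewrite hc; lra.
pose k2 := m * y `^ (m - 1) / K.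
have k20 : 0 < k2 by rewrite divr_gt0// mulr_gt0 ?powR_gt0//; lra.
have sge (x : R) : y < x < c -> k2 / (c - x) <= m * x `^ (m - 1) / W x.
  move=> /andP[yx xc].
  have x0c : 0 < x < c by lra.
  have cx : 0 < c - x by lra.
  have WK : W x <= K * (c - x) by apply: le_trans (hK x x0c); case/andP: (hW x x0c).
  rewrite ler_pdivlMr ?W0//.
  apply: le_trans (_ : k2 / (c - x) * (K * (c - x)) <= _).
    by rewrite ler_pM2l// divr_gt0.
  have -> : k2 / (c - x) * (K * (c - x)) = m * y `^ (m - 1).
    by rewrite /k2; field; rewrite !gt_eqF.
  rewrite ler_pM2l; last lra.
  by apply: ge0_ler_powR; rewrite ?nnegrE; lra.
have dln (x : R) : x < c ->
    is_derive x 1 (fun t : R => k2 * ln (c - t)) (- (k2 / (c - x))).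
  move=> xc; have cx : 0 < c - x by lra.
  have dc : is_derive x 1 (fun t : R => c - t) (- 1).
    by rewrite -[- 1]add0r; apply: is_deriveB.
  have dl : is_derive (c - x) 1 (@ln R) (c - x)^-1 by exact: is_derive1_ln.
  apply: (is_derive_eq (is_deriveZ k2 (@is_derive1_comp R (@ln R) (fun t => c - t) x _ _ dl dc))).
  by rewrite /GRing.scale/= mulrN1 mulrN.
have Sz (t : R) : 0 < t -> S0 z + k2 * t <= S0 (c - (c - z) * expR (- t)).
  move=> t0.
  have et0 : 0 < expR (- t) by exact: expR_gt0.
  have et1 : expR (- t) < 1 by rewrite expR_lt1; lra.
  have cz : 0 < c - z by lra.
  set x := c - (c - z) * expR (- t).
  have zx : z <= x by rewrite /x; nra.
  have xc : x < c by rewrite /x; nra.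
  have lx : ln (c - x) = ln (c - z) - t.
    by rewrite /x opprB addrC subrK lnM ?posrE// expRK.
  have : S0 z + k2 * ln (c - z) <= S0 x + k2 * ln (c - x).
    apply: (@derive1_ge0_homo R y c (fun t : R => S0 t + k2 * ln (c - t))
      (fun t => m * t `^ (m - 1) / W t - k2 / (c - t))) => // r /andP[yr rc].
    - by apply: is_deriveD; [apply: dS0; lra|exact: dln].
    - by rewrite subr_ge0 sge// yr.
  by rewrite lx; lra.
pose l := inf [set S0 x | x in [set x : R | 0 < x < c]].
have lS (x : R) : 0 < x < c -> l <= S0 x.
  move=> xc; apply: ge_inf; last by exists x.
  exists (S0 y - C * y `^ (1 - q)) => _ [r /= rc <-].
  have [ry|yr] := ltP r y; first by apply: Sy => //; case/andP: rc.
  have : S0 y <= S0 r.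
    by move: yr; rewrite le_eqVlt => /predU1P[->//|yr]; apply/ltW/S0lt; lra.
  have : 0 <= C * y `^ (1 - q) by rewrite mulr_ge0 ?powR_ge0 ?ltW.
  by lra.
exists (fun x => S0 x - l); split.
- move=> x xc; rewrite -[X in is_derive _ _ _ X]subr0.
  by apply: is_deriveB; exact: dS0.
- move=> x xc; rewrite subr_gt0; apply: le_lt_trans (lS (x / 2) _) _; first lra.
  by apply: S0lt; lra.
- move=> e e0.
  have [|_ [x xc <-] xl] := @inf_adherent R [set S0 x | x in [set x : R | 0 < x < c]] e e0.
    split; first by exists (S0 y); exists y.
    by exists l => _ [r rc <-]; exact: lS.
  by exists x => //; rewrite ltrBlDl.
- move=> M; pose t := Num.max 1 ((M + l - S0 z) / k2 + 1).
  have t0 : 0 < t by rewrite lt_max ltr01.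
  have : (M + l - S0 z) / k2 < t by rewrite lt_max ltrDl ltr01 orbT.
  rewrite ltr_pdivrMr// => tM.
  have et0 : 0 < expR (- t) by exact: expR_gt0.
  have et1 : expR (- t) < 1 by rewrite expR_lt1; lra.
  exists (c - (c - z) * expR (- t)); first by rewrite /z; nra.
  by have := Sz _ t0; rewrite mulrC in tM; lra.
Qed.

(** The position at time [- ln xi] before the interface. *)
Lemma clock_inverse (R : realType) (c : R) (S s : R -> R) :
  (forall x, 0 < x < c -> is_derive x 1 S (s x)) ->
  (forall x, 0 < x < c -> 0 < s x) ->
  (forall x, 0 < x < c -> 0 < S x) ->
  (forall e, 0 < e -> exists2 x, 0 < x < c & S x < e) ->
  (forall M, exists2 x, 0 < x < c & M < S x) ->
  exists v : R -> R,
    [/\ forall xi : R, 0 < xi < 1 -> 0 < v xi < c,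
        forall xi : R, 0 < xi < 1 -> S (v xi) = - ln xi,
        forall xi x : R, 0 < xi < 1 -> 0 < x < c -> S x = - ln xi -> x = v xi,
        forall xi : R, 0 < xi < 1 -> is_derive xi 1 v (- (s (v xi))^-1 / xi) &
        v xi @[xi --> 1^'-] --> 0 /\ v xi @[xi --> 0^'+] --> c].
Proof.
move=> dS s0 S0 Ssmall Slarge.
have Slt := derive1_gt0_homo _ _ _ _ _ dS s0.
have Smono (x y : R) : 0 < x < c -> 0 < y < c -> S x < S y -> x < y.
  move=> /andP[x0 xc] /andP[y0 yc] Sxy; rewrite ltNge le_eqVlt.
  apply/negP => /predU1P[xy|yx]; first by rewrite xy ltxx in Sxy.
  by have := Slt y x y0 yx xc; rewrite ltNge ltW.
have Sinj (x y : R) : 0 < x < c -> 0 < y < c -> S x = S y -> x = y.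
  move=> /andP[x0 xc] /andP[y0 yc] Sxy.
  by have [xy|yx|//] := ltgtP x y; [have := Slt x y x0 xy yc|have := Slt y x y0 yx xc];
    rewrite Sxy ltxx.
have /choice[g hg] (t : R) : exists x : R, 0 < t -> 0 < x < c /\ S x = t.
  have [t0|] := ltP 0 t; last by exists 0.
  have [x1 x1c S1] := Ssmall t t0; have [x2 x2c S2] := Slarge t.
  have x12 : x1 < x2 by apply: Smono => //; exact: lt_trans S2.
  have [|||x] := @IVT R S x1 x2 t.
  - exact: ltW.
  - apply: continuous_in_subspaceT => z /set_mem/=; rewrite in_itv/= => x1z.
    have zc : 0 < z < c by lra.
    exact: is_derive1_continuous (dS _ zc).
  - by rewrite ge_min le_max (ltW S1) (ltW S2) orbT.
  - by rewrite in_itv/= => x1x Sxt; exists x => _; split=> //; lra.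
have gS x : 0 < x < c -> g (S x) = x.
  by move=> xc; have [gc SgS] := hg _ (S0 _ xc); exact: Sinj.
have dg x : 0 < x < c -> is_derive (S x) 1 g (s x)^-1.
  move=> xc; apply: is_derive_inverse; last 2 first.
  - exact: dS.
  - by rewrite gt_eqF// s0.
  - near=> y; apply: gS; near: y; exact: (near_in_itvoo xc).
  - near=> y; have yc : 0 < y < c by near: y; exact: (near_in_itvoo xc).
    exact: is_derive1_continuous (dS _ yc).
have lnN (xi : R) : 0 < xi < 1 -> 0 < - ln xi by move=> /ln_lt0; lra.
exists (fun xi => g (- ln xi)); split.
- by move=> xi /lnN/hg[].
- by move=> xi /lnN/hg[].
- by move=> xi x xi01 xc <-; rewrite gS.
- move=> xi /[dup] xi01 /lnN/hg [gc Sg].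
  have xi0 : 0 < xi by case/andP: xi01.
  have dl : is_derive xi 1 (fun t : R => - ln t) (- xi^-1).
    by apply: is_deriveN; exact: is_derive1_ln.
  have := dg _ gc; rewrite Sg => dg'.
  apply: (is_derive_eq (@is_derive1_comp R g (fun t => - ln t) xi _ _ dg' dl)).
  by rewrite mulrN mulNr.
- have c0 : 0 < c by have [x2 + _] := Slarge 0; lra.
  have near_clock (x : R) : 0 < x < c -> 0 < expR (- S x) < 1.
    by move=> xc; rewrite expR_gt0 expR_lt1 oppr_lt0 S0.
  have gmin e : 0 < e -> 0 < Num.min (e / 2) (c / 2) < c /\ Num.min (e / 2) (c / 2) < e.
    by move=> e0; rewrite lt_min !gt_min; lra.
  split; apply/cvgrPdist_lt => e e0; have [dc de] := gmin _ e0.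
    have /andP[x0 x1] := near_clock _ dc; near=> xi.
    have xix : expR (- S (Num.min (e / 2) (c / 2))) < xi.
      by near: xi; exact: nbhs_left_gt.
    have xi01 : 0 < xi < 1.
      by rewrite (lt_trans x0 xix); near: xi; exact: nbhs_left_lt.
    have [gc Sg] := hg _ (lnN _ xi01).
    have : g (- ln xi) < Num.min (e / 2) (c / 2).
      apply: Smono => //; rewrite Sg ltrNl -[ltLHS]expRK ltr_ln ?posrE//.
    by rewrite sub0r normrN gtr0_norm; lra.
  have dc' : 0 < c - Num.min (e / 2) (c / 2) < c by lra.
  have /andP[x0 x1] := near_clock _ dc'; near=> xi.
  have xix : xi < expR (- S (c - Num.min (e / 2) (c / 2))).
    by near: xi; exact: nbhs_right_lt.
  have xi01 : 0 < xi < 1.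
    by rewrite (lt_trans xix x1) andbT; near: xi; exact: nbhs_right_gt.
  have [gc Sg] := hg _ (lnN _ xi01).
  have : c - Num.min (e / 2) (c / 2) < g (- ln xi).
    apply: Smono => //; rewrite Sg ltrNr -[ltRHS]expRK ltr_ln ?posrE//.
  by rewrite gtr0_norm; lra.
Unshelve. all: by end_near.
Qed.

(** * Emden variables *)

(** The exponents [p] and [sigma] are chosen so that these powers of [xi] cancel
in the equation: [p * (m - 1) = 2] and [sigma + p * q = p]. *)
Lemma self_similar_powers (R : realType) (m q sigma p xi U : R) :
  1 < m -> p = 2 / (m - 1) -> sigma = p * (1 - q) -> 0 < xi -> 0 < U ->
  [/\ (xi `^ p * U) `^ (m - 1) = xi ^+ 2 * U `^ (m - 1),
      (xi `^ p * U) `^ m = xi `^ p * xi ^+ 2 * (U `^ (m - 1) * U),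
      xi `^ sigma * (xi `^ p * U) `^ q = xi `^ p * U `^ q,
      xi `^ (p + 1) = xi `^ p * xi &
      xi `^ (p - 1) = xi `^ p / xi].
Proof.
move=> m1 hp hs xi0 U0.
have X0 : 0 < xi `^ p by exact: powR_gt0.
have m10 : m - 1 != 0 by rewrite gt_eqF// subr_gt0.
have powS (x r : R) : 0 < x -> x `^ (r + 1) = x `^ r * x.
  by move=> x0; rewrite gt0_powRD// powRr1// ltW.
have e1 : (xi `^ p * U) `^ (m - 1) = xi ^+ 2 * U `^ (m - 1).
  rewrite powRM ?ltW// -powRrM hp mulfVK// powR_mulrn// ltW//.
split=> //.
- rewrite -{1}[m](subrK 1) powS ?mulr_gt0// e1.
  by rewrite mulrACA [_ * xi `^ p]mulrC.
- rewrite powRM ?ltW// mulrA; congr (_ * _).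
  by rewrite -powRrM -gt0_powRD// hs; congr (_ `^ _); lra.
- exact: powS.
- by rewrite gt0_powRD// powR_inv1// ltW.
Qed.

(** The first equation is the definition of [w], as [dw = (f `^ m)'] by the chain
rule; the second one is the profile equation. *)
Lemma emden_of_profile (R : realType) (N : nat) (m q sigma p beta xi : R)
    (f dw : R -> R) :
  1 < m -> p = 2 / (m - 1) -> sigma = p * (1 - q) -> 0 < xi -> 0 < f xi ->
  is_derive xi 1 (fun t : R => f t `^ m) (dw xi) ->
  profile_ode N q sigma (p * beta) beta f dw xi ->
  let A := 2 * p + N%:R + 2 in
  let B := (p + 2) * (p + N%:R) in
  let u t := f t / t `^ p in
  let w t := (p + 2) * u t `^ m - dw t / t `^ (p + 1) in
  is_derive xi 1 u (- (w xi / (m * u xi `^ (m - 1))) / xi) /\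
  is_derive xi 1 w ((- (m * A * u xi `^ (m - 1) - beta) * (w xi / (m * u xi `^ (m - 1)))
    - excess m q B (u xi)) / xi).
Proof.
move=> m1 hp hs xi0 f0 dfm [/derivableP df /derivableP ddw ode] A B u w.
rewrite -derive1E in df; rewrite -derive1E in ddw.
have X0 : 0 < xi `^ p by exact: powR_gt0.
have u0 : 0 < u xi by rewrite divr_gt0.
have fu : f xi = xi `^ p * u xi by rewrite /u mulrC divfK// gt_eqF.
have [e1 e2 e3 e4 e5] := self_similar_powers _ _ q _ _ _ _ m1 hp hs xi0 u0.
have dwE : dw xi = m * (xi ^+ 2 * u xi `^ (m - 1)) * derive1 f xi.
  have := @is_derive1_comp R (fun t : R => t `^ m) f xi _ _ (is_derive1_powR m f0) df.
  by rewrite -e1 -fu => /(@derive_val _ _ _) <-; case: dfm.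
have uU : u xi `^ m = u xi `^ (m - 1) * u xi.
  by rewrite mulrC mulr_powRB1// ?ltW//; lra.
have du0 := is_derive1M _ _ _ _ _ _ df
  (is_derive1V _ (fun t : R => t `^ p) _ _ (lt0r_neq0 X0) (is_derive1_powR p xi0)).
have Um0 : 0 < u xi `^ (m - 1) by exact: powR_gt0.
have m1n : m - 1 != 0 by rewrite gt_eqF// subr_gt0.
have mn : m != 0 by rewrite gt_eqF//; lra.
have wE : w xi = u xi `^ (m - 1) * ((p + 2) * u xi - m * xi * derive1 f xi / xi `^ p).
  by rewrite /w dwE e4 uU; field; rewrite !gt_eqF.
have du : is_derive xi 1 u (- (w xi / (m * u xi `^ (m - 1))) / xi).
  apply: (is_derive_eq du0); rewrite wE e5 fu.
  move: (xi `^ p) (u xi) (u xi `^ (m - 1)) (derive1 f xi) X0 u0 Um0 => X U Um fd X0 U0 Um0.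
  by rewrite hp; field; rewrite m1n mn !gt_eqF.
split; first exact: du.
have dum := is_deriveZ (p + 2)
  (@is_derive1_comp R (fun t : R => t `^ m) u xi _ _ (is_derive1_powR m u0) du).
have X10 : xi `^ (p + 1) != 0 by rewrite gt_eqF// powR_gt0.
have ddwX := is_derive1M _ _ _ _ _ _ ddw
  (is_derive1V _ (fun t : R => t `^ (p + 1)) _ _ X10 (is_derive1_powR (p + 1) xi0)).
apply: (is_derive_eq (is_deriveB dum ddwX)).
rewrite /GRing.scale/= addrK e4 /excess uU.
have {ode} -> : derive1 dw xi = - ((N%:R - 1) / xi * dw xi + p * beta * (xi `^ p * u xi)
    - beta * xi * derive1 f xi - xi `^ p * u xi `^ q).
  by move: ode; rewrite fu -e3; lra.
rewrite wE dwE /B /A.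
move: (xi `^ p) (u xi) (u xi `^ (m - 1)) (derive1 f xi) (u xi `^ q) X0 u0 Um0.
move=> X U Um fd Uq X0 U0 Um0; rewrite hp; field.
by rewrite m1n mn !gt_eqF.
Qed.

Lemma profile_of_emden (R : realType) (N : nat) (m q sigma p beta xi : R)
    (f dw v w : R -> R) :
  1 < m -> p = 2 / (m - 1) -> sigma = p * (1 - q) -> 0 < xi < 1 ->
  let A := 2 * p + N%:R + 2 in
  let B := (p + 2) * (p + N%:R) in
  0 < v xi ->
  (forall t : R, 0 < t < 1 -> f t = t `^ p * v t) ->
  (forall t : R, 0 < t < 1 -> dw t = t `^ (p + 1) * ((p + 2) * v t `^ m - w t)) ->
  is_derive xi 1 v (- (w xi / (m * v xi `^ (m - 1))) / xi) ->
  is_derive xi 1 w ((- (m * A * v xi `^ (m - 1) - beta) * (w xi / (m * v xi `^ (m - 1)))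
    - excess m q B (v xi)) / xi) ->
  is_derive xi 1 (fun t : R => f t `^ m) (dw xi) /\
  profile_ode N q sigma (p * beta) beta f dw xi.
Proof.
move=> m1 hp hs /[dup] xi01 /andP[xi0 _] A B v0 fE dwE dv hw.
have X0 : 0 < xi `^ p by exact: powR_gt0.
have [e1 e2 e3 e4 e5] := self_similar_powers _ _ q _ _ _ _ m1 hp hs xi0 v0.
have m1n : m - 1 != 0 by rewrite gt_eqF// subr_gt0.
have mn : m != 0 by rewrite gt_eqF//; lra.
have V0 : 0 < v xi `^ (m - 1) by exact: powR_gt0.
have fx := fE _ xi01; have f0 : 0 < f xi by rewrite fx mulr_gt0.
have vU : v xi `^ m = v xi `^ (m - 1) * v xi.
  by rewrite mulrC mulr_powRB1// ?ltW//; lra.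
have df0 := is_derive1M _ (fun t : R => t `^ p) v _ _ _ (is_derive1_powR p xi0) dv.
have {df0}df : is_derive xi 1 f (xi `^ p / xi * (p * v xi - w xi / (m * v xi `^ (m - 1)))).
  apply: (is_derive1_ext _ _ _ 0 1 _ _ _ xi01 (is_derive_eq df0 _)).
    by move=> t /fE.
  by rewrite e5; field; rewrite mn !gt_eqF.
have dfm : is_derive xi 1 (fun t : R => f t `^ m) (dw xi).
  apply: (is_derive_eq (@is_derive1_comp R (fun t : R => t `^ m) f xi _ _
    (is_derive1_powR m f0) df)).
  rewrite fx e1 (dwE _ xi01) e4 vU hp; field.
  by rewrite m1n mn !gt_eqF.
split=> //.
have dvm := is_deriveZ (p + 2)
  (@is_derive1_comp R (fun t : R => t `^ m) v xi _ _ (is_derive1_powR m v0) dv).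
have ddw0 := is_derive1M _ (fun t : R => t `^ (p + 1)) _ _ _ _
  (is_derive1_powR (p + 1) xi0) (is_deriveB dvm hw).
have {ddw0 dvm}ddw := is_derive1_ext _ _ dw 0 1 _ _
  (fun t t01 => esym (dwE t t01)) xi01 ddw0.
have dfE : derive1 f xi = xi `^ p / xi * (p * v xi - w xi / (m * v xi `^ (m - 1))).
  by rewrite derive1E; case: df.
have ddwE := @derive_val _ _ _ _ _ _ _ ddw; rewrite -derive1E in ddwE.
split; [by case: df|by case: ddw|].
rewrite ddwE dfE fx e3 (dwE _ xi01) /GRing.scale/= addrK e4 /excess.
rewrite -[X in _ * X + _]/((p + 2) * v xi `^ m - w xi) vU /B /A.
move: (xi `^ p) (v xi) (v xi `^ (m - 1)) (v xi `^ q) X0 v0 V0.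
move=> X U Um Uq X0 U0 Um0; rewrite hp; field.
by rewrite m1n mn !gt_eqF.
Qed.

(** * Uniqueness of the trajectory *)

(** On an interval up to 1 on which [u < c], the squared distance of the trajectory
to the curve [w = W u] is nondecreasing and tends to 0 at 1, so the trajectory
lies on the curve; it then follows the same clock as [v], whence [u = v].  If
[u] took a value [>= c], then at the supremum [s] of such points [u] would equal
[v < c] by continuity from the right. *)
Lemma emden_unique (R : realType) (m q A B c beta : R) (W S u v w : R -> R) :
  1 < m -> 0 < q -> 0 < B ->
  (forall x, 0 < x < c -> 0 < W x <= excess m q B x) ->
  (forall x, 0 < x < c -> is_derive x 1 W
     (m * A * x `^ (m - 1) - beta + m * x `^ (m - 1) * excess m q B x / W x)) ->
  (forall x, 0 < x < c -> is_derive x 1 S (m * x `^ (m - 1) / W x)) ->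
  (forall x, 0 < x < c -> 0 < S x) ->
  (forall e, 0 < e -> exists2 x, 0 < x < c & S x < e) ->
  (forall xi : R, 0 < xi < 1 -> 0 < v xi < c) ->
  (forall xi : R, 0 < xi < 1 -> {for xi, continuous v}) ->
  (forall xi x : R, 0 < xi < 1 -> 0 < x < c -> S x = - ln xi -> x = v xi) ->
  (forall xi : R, 0 < xi < 1 -> 0 < u xi) ->
  (forall xi : R, 0 < xi < 1 ->
     is_derive xi 1 u (- (w xi / (m * u xi `^ (m - 1))) / xi)) ->
  (forall xi : R, 0 < xi < 1 -> is_derive xi 1 w
     ((- (m * A * u xi `^ (m - 1) - beta) * (w xi / (m * u xi `^ (m - 1)))
       - excess m q B (u xi)) / xi)) ->
  u xi @[xi --> 1^'-] --> 0 -> w xi @[xi --> 1^'-] --> 0 ->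
  forall xi : R, 0 < xi < 1 -> u xi = v xi.
Proof.
move=> m1 q0 B0 hW dW dS S0 Ssmall vc cv vP u0 du dw u1 w1.
set h := excess m q B in hW dW dw.
have W0 x : 0 < x < c -> 0 < W x by move=> /hW/andP[].
have s0 (x : R) : 0 < x < c -> 0 < m * x `^ (m - 1) / W x.
  move=> xc; rewrite divr_gt0 ?W0// mulr_gt0 ?powR_gt0//; first lra.
  by case/andP: xc.
have Slt := derive1_gt0_homo _ _ _ _ _ dS s0.
have usmall (d : R) : 0 < d -> \forall xi \near 1^'-, u xi < d.
  move=> d0; move/cvgrPdist_lt : u1 => /(_ _ d0); apply: filterS => xi.
  by rewrite sub0r normrN; apply: le_lt_trans; rewrite ler_norm.
have near01 : \forall xi \near (1 : R)^'-, 0 < xi < 1.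
  near=> xi; apply/andP; split; near: xi; first exact: nbhs_left_gt.
  exact: nbhs_left_lt.
have uq1 : u xi `^ q @[xi --> 1^'-] --> 0.
  by apply: cvg_powR0 => //; apply: filterS near01 => xi /u0/ltW.
have Wu (e : R) : 0 < e -> \forall xi \near 1^'-, u xi < c -> W (u xi) < e.
  move=> e0; near=> xi => uc.
  have u0c : 0 < u xi < c by rewrite uc andbT u0//; near: xi.
  have uqe : `|0 - u xi `^ q| < e by near: xi; move/cvgrPdist_lt : uq1; exact.
  have [_ Wh] := andP (hW _ u0c); apply: le_lt_trans Wh _.
  apply: le_lt_trans uqe; rewrite sub0r normrN ger0_norm ?powR_ge0//.
  by rewrite gerBl mulr_ge0 ?powR_ge0// ltW.
have key xi1 : 0 <= xi1 -> xi1 < 1 -> (forall xi : R, xi1 < xi < 1 -> u xi < c) ->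
    forall xi : R, xi1 < xi < 1 -> u xi = v xi.
  move=> xi10 xi11 uc.
  have in01 (xi : R) : xi1 < xi < 1 -> 0 < xi < 1.
    by case/andP=> x1 ->; rewrite (le_lt_trans xi10 x1).
  have u0c (xi : R) : xi1 < xi < 1 -> 0 < u xi < c.
    by move=> xi01; rewrite u0 ?uc// in01.
  have near1 : \forall xi \near (1 : R)^'-, xi1 < xi < 1.
    near=> xi; apply/andP; split; near: xi; first exact: nbhs_left_gt.
    exact: nbhs_left_lt.
  pose D xi := w xi - W (u xi).
  have dD (xi : R) : xi1 < xi < 1 ->
      is_derive xi 1 D (h (u xi) / W (u xi) / xi * D xi).
    move=> xi01; have xi0 := in01 _ xi01; have uxc := u0c _ xi01.
    have dWu := @is_derive1_comp R W u xi _ _ (dW _ uxc) (du _ xi0).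
    apply: (is_derive_eq (is_deriveB (dw _ xi0) dWu)).
    have Wu0 := W0 _ uxc; have [U0 _] := andP uxc; have [x0 _] := andP xi0.
    have V0 : 0 < u xi `^ (m - 1) by exact: powR_gt0.
    rewrite /D; move: (W (u xi)) (u xi `^ (m - 1)) (h (u xi)) Wu0 V0 => Y V H Y0 V0.
    by field; rewrite !gt_eqF//; lra.
  (* the coefficient is positive, so [D ^+ 2] cannot decrease towards 1 *)
  have D2 (x y : R) : xi1 < x -> x <= y -> y < 1 -> D x * D x <= D y * D y.
    apply: (@derive1_ge0_homo R xi1 1 (fun t => D t * D t)
      (fun xi => h (u xi) / W (u xi) / xi * D xi * D xi +
                 D xi * (h (u xi) / W (u xi) / xi * D xi))) => xi xi01.
      by apply: is_derive1M; exact: dD.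
    have [W0' Wh] := andP (hW _ (u0c _ xi01)).
    have k0 : 0 <= h (u xi) / W (u xi) / xi.
      by rewrite !divr_ge0 ?(le_trans (ltW W0') Wh)// ltW//; case/andP: (in01 _ xi01).
    by have := mulr_ge0 k0 (sqr_ge0 (D xi)); rewrite expr2; lra.
  have D0 (xi : R) : xi1 < xi < 1 -> D xi = 0.
    move=> xi01; apply/eqP; rewrite -[_ == _]orbb -mulf_eq0 eq_le.
    rewrite -expr2 sqr_ge0 andbT; apply/ler_addgt0Pr => e e0; rewrite add0r.
    pose d := Num.min e 1 / 2.
    have d0 : 0 < d by rewrite divr_gt0// lt_min e0 ltr01.
    have de : 2 * d <= e by rewrite /d mulrC mulfVK// ge_min lexx.
    have d1 : 2 * d <= 1 by rewrite /d mulrC mulfVK// ge_min lexx orbT.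
    near (1 : R)^'- => y.
    have y1 : xi1 < y < 1 by near: y.
    have xiy : xi <= y.
      by apply: ltW; near: y; apply: nbhs_left_gt; case/andP: xi01.
    have wd : `|w y| < d.
      by rewrite -normrN -sub0r; near: y; move/cvgrPdist_lt : w1; exact.
    have Wd : W (u y) < d by apply: (near (Wu d d0) y) => //; exact: uc.
    have Wp := W0 _ (u0c _ y1).
    have [x1 _] := andP xi01; have [_ y1'] := andP y1.
    rewrite expr2; apply: le_trans (D2 _ _ x1 xiy y1') _.
    by move: wd; rewrite ltr_norml /D => /andP[wd1 wd2]; nra.
  have wW (xi : R) : xi1 < xi < 1 -> w xi = W (u xi).
    by move=> /D0/eqP; rewrite subr_eq0 => /eqP.
  (* [T = 0] says that [u] reaches the interface exactly at [xi = 1] *)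
  pose T xi := S (u xi) + ln xi.
  have dT (xi : R) : xi1 < xi < 1 -> is_derive xi 1 T 0.
    move=> xi01; have xi0 := in01 _ xi01; have uxc := u0c _ xi01.
    have [x0 _] := andP xi0.
    have dSu := @is_derive1_comp R S u xi _ _ (dS _ uxc) (du _ xi0).
    apply: (is_derive_eq (is_deriveD dSu (is_derive1_ln x0))).
    have Wu0 := W0 _ uxc; have [U0 _] := andP uxc.
    have V0 : 0 < u xi `^ (m - 1) by exact: powR_gt0.
    rewrite wW//; field.
    by rewrite !gt_eqF//; lra.
  move=> xi xi01; apply: vP; [exact: in01|exact: u0c|].
  apply/eqP; rewrite -addr_eq0; apply/eqP; rewrite -/(T xi).
  have Ty y : xi1 < y < 1 -> T xi = T y by exact: derive1_0_cst.
  have Tle e : 0 < e -> - e <= T xi <= e.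
    move=> e0; have [x xc Sx] := Ssmall e e0.
    have [x0 xc'] := andP xc.
    near (1 : R)^'- => y.
    have y1 : xi1 < y < 1 by near: y.
    rewrite (Ty y y1) /T.
    have [y0 y1'] := andP (in01 _ y1).
    have [uy0 uyc] := andP (u0c _ y1).
    have ux : u y < x by near: y; exact: usmall.
    have := Slt _ _ uy0 ux xc'; have := S0 _ (u0c _ y1).
    have := ln_lt0 (in01 _ y1).
    have ye : expR (- e) < y.
      by near: y; apply: nbhs_left_gt; rewrite expR_lt1 oppr_lt0.
    have : - e < ln y by rewrite -[ltLHS]expRK ltr_ln ?posrE// expR_gt0.
    by lra.
  apply/eqP; rewrite eq_le; apply/andP; split; apply/ler_addgt0Pr => e e0.
    by rewrite add0r; case/andP: (Tle e e0).
  by have /andP[? _] := Tle e e0; lra.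
have uc (xi : R) : 0 < xi < 1 -> u xi < c.
  move=> xi01; rewrite ltNge; apply/negP => cu.
  pose E := [set x : R | 0 < x < 1 /\ c <= u x].
  have [h1 h1lt uh1] : exists2 r : R, r < 1 & forall x, r < x < 1 -> u x < c.
    have c0 : 0 < c by have := vc _ xi01; lra.
    have [d /= d0 hd] := usmall c c0.
    exists (1 - d) => [|x /andP[x1 x2]]; first lra.
    by apply: hd => //=; rewrite gtr0_norm; lra.
  have Eub : ubound E h1.
    move=> x [/andP[x0 x1] cx]; rewrite leNgt; apply/negP => h1x.
    by have := uh1 x; rewrite h1x x1 => /(_ isT); rewrite ltNge cx.
  have Exi : E xi by [].
  have supE : has_sup E by split; [exists xi|exists h1].
  set s := sup E.
  have xis : xi <= s by apply: ub_le_sup => //; exists h1.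
  have sh1 : s <= h1 by apply: ge_sup => //; exists xi.
  have s01 : 0 < s < 1 by lra.
  have us (x : R) : s < x < 1 -> u x < c.
    move=> /andP[sx x1]; rewrite ltNge; apply/negP => cx.
    have : x <= s by apply: ub_le_sup; [exists h1|split=> //; lra].
    by rewrite leNgt sx.
  have cu0 := is_derive1_continuous _ _ _ _ (du _ s01).
  have uv : u s = v s.
    have us' : u x @[x --> s^'+] --> u s by exact: cvg_at_right_filter cu0.
    have vs' : v x @[x --> s^'+] --> v s by exact: cvg_at_right_filter (cv _ s01).
    apply: (cvg_unique _ us'); first exact: Rhausdorff.
    apply: cvg_trans vs'; apply: near_eq_cvg; near=> x.
    apply/esym/(key s) => //; try lra.
    by apply/andP; split; near: x; [exact: nbhs_right_gt|apply: nbhs_right_lt; lra].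
  have : u s < c by rewrite uv; case/andP: (vc _ s01).
  rewrite -subr_gt0 => cus; move/cvgrPdist_lt : cu0 => /(_ _ cus) [d /= d0 hd].
  have [y [y01 cy]] := sup_adherent d0 supE; rewrite -/s => sy.
  have ys : y <= s by apply: ub_le_sup => //; exists h1.
  have /hd : `|s - y| < d by rewrite ger0_norm; lra.
  by rewrite ltr_norml; lra.
move=> xi xi01; apply: (key 0) => // x x01; exact: uc.
Unshelve. all: by end_near.
Qed.

(** * Profiles cut off at the interface *)

Lemma within_continuous_cutoff (R : realType) (F : R -> R) :
  F 0 = 0 -> (forall xi : R, 1 <= xi -> F xi = 0) ->
  (forall xi : R, 0 < xi < 1 -> {for xi, continuous F}) ->
  F xi @[xi --> 0^'+] --> 0 -> F xi @[xi --> 1^'-] --> 0 ->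
  {within `[0, +oo[%classic, continuous F}.
Proof.
move=> F0 F1 cF Fl Fr; apply/continuous_within_itvcyP; split; last by rewrite F0.
move=> xi; rewrite in_itv/= andbT => xi0.
have [xi1|xi1|->] := ltgtP xi 1.
- by apply: cF; rewrite xi0.
- have F10 : F xi = 0 by apply: F1; exact: ltW.
  rewrite /continuous_at F10; apply: cvg_near_cst; near=> y.
  apply: F1; apply: ltW; near: y; exact: lt_nbhsr.
- apply/left_right_continuousP; split; rewrite F1//.
  apply: cvg_near_cst; near=> y.
  by apply: F1; apply: ltW; near: y; exact: nbhs_right_gt.
Unshelve. all: by end_near. Qed.

(** At the end points 0 and 1 the mean value theorem turns the limit of the
derivative into the derivative. *)
Lemma C1_halfline_cutoff (R : realType) (F dF : R -> R) :
  F 0 = 0 -> (forall xi : R, 1 <= xi -> F xi = 0) ->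
  dF 0 = 0 -> (forall xi : R, 1 <= xi -> dF xi = 0) ->
  (forall xi : R, 0 < xi < 1 -> is_derive xi 1 F (dF xi)) ->
  F xi @[xi --> 0^'+] --> 0 -> F xi @[xi --> 1^'-] --> 0 ->
  {within `[0, +oo[%classic, continuous dF} ->
  C1_halfline F dF.
Proof.
move=> F0 F1 dF0 dF1 hF Fl Fr cdF.
have cF : {within `[0, +oo[%classic, continuous F}.
  apply: within_continuous_cutoff => // xi xi01.
  exact: is_derive1_continuous (hF _ xi01).
have mvt (x y : R) : 0 <= x -> x < y -> y <= 1 ->
    exists2 z : R, x < z < y & F y - F x = dF z * (y - x).
  move=> x0 xy y1.
  have [||z zxy Fz] := @MVT R F dF x y xy.
  - by move=> z; rewrite in_itv/= => zxy; apply: hF; lra.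
  - apply: continuous_subspaceW cF => z/=; rewrite !in_itv/= andbT.
    by case/andP=> xz _; exact: le_trans xz.
  - by exists z.
have [cdF1 cdF0] := (continuous_within_itvcyP 0 dF).1 cdF.
split=> //; last first.
  rewrite dF0 F0; apply/cvgrPdist_lt => e e0.
  move: cdF0; rewrite dF0 => /cvgrPdist_lt /(_ _ e0) [d /= d0 hd].
  near=> h.
  have h0 : 0 < h by near: h; exact: nbhs_right_gt.
  have h1 : h <= 1 by near: h; exact: nbhs_right_le.
  have hd' : h < d by near: h; exact: nbhs_right_lt.
  have [z /andP[z0 zh]] := mvt 0 h (lexx _) h0 h1.
  rewrite F0 !subr0 => ->; rewrite mulrC mulfK ?gt_eqF//.
  by apply: hd => //=; rewrite sub0r normrN gtr0_norm//; lra.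
move=> xi xi0; have [xi1|xi1|->] := ltgtP xi 1.
- by apply: hF; rewrite xi0.
- rewrite dF1 ?ltW//; apply: (@near_eq_is_derive _ _ _ (fun=> 0)).
  near=> y; apply/esym/F1/ltW; near: y; exact: lt_nbhsr.
- rewrite dF1//; apply/is_derive1_caratheodory.
  exists (fun z => (F z - F 1) / (z - 1)); split.
  + move=> z; have [->|z1] := eqVneq z 1; first by rewrite !subrr mulr0.
    by rewrite mulfVK// subr_eq0.
  + apply/cvgrPdist_lt => e e0; rewrite /= subrr mul0r.
    have := cdF1 1; rewrite in_itv/= ltr01 => /(_ isT).
    rewrite /continuous_at dF1// => /cvgrPdist_lt /(_ _ e0) [d /= d0 hd].
    have near1 : \forall z \near (1 : R), 0 < z /\ `|1 - z| < d.
      near=> z; split; near: z; first exact: lt_nbhsr.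
      by exists d.
    apply: filterS near1 => z [z0 zd].
    rewrite sub0r normrN; have [z1|z1] := leP 1 z.
      by rewrite !F1// subrr mul0r normr0.
    have [y /andP[zy y1] Fy] := mvt z 1 (ltW z0) z1 (lexx _).
    have -> : (F z - F 1) / (z - 1) = dF y.
      by rewrite -opprB Fy -mulrN opprB mulfK// subr_eq0 lt_eqF.
    have := hd y; rewrite sub0r normrN; apply.
    by move: zd; rewrite /= !gtr0_norm; lra.
  + by rewrite subrr mul0r.
Unshelve. all: by end_near. Qed.

Lemma is_profile_of_emden (R : realType) (N : nat) (m q sigma p beta c : R)
    (v w : R -> R) :
  1 < m -> 0 < q -> p = 2 / (m - 1) -> sigma = p * (1 - q) -> 0 < c ->
  let A := 2 * p + N%:R + 2 in
  let B := (p + 2) * (p + N%:R) in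
  (forall xi : R, 0 < xi < 1 -> 0 < v xi < c) ->
  (forall xi : R, 0 < xi < 1 -> 0 <= w xi <= v xi `^ q) ->
  (forall xi : R, 0 < xi < 1 ->
     is_derive xi 1 v (- (w xi / (m * v xi `^ (m - 1))) / xi)) ->
  (forall xi : R, 0 < xi < 1 -> is_derive xi 1 w
     ((- (m * A * v xi `^ (m - 1) - beta) * (w xi / (m * v xi `^ (m - 1)))
       - excess m q B (v xi)) / xi)) ->
  v xi @[xi --> 0^'+] --> c -> v xi @[xi --> 1^'-] --> 0 ->
  is_profile N m q sigma (p * beta) beta
    (fun xi => if 0 < xi < 1 then xi `^ p * v xi else 0).
Proof.
move=> m1 q0 hp hs c0 A B vc wq dv hw vl vr.
have m0 : 0 < m by lra.
have p0 : 0 < p by rewrite hp divr_gt0//; lra.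
have near0 : \forall xi \near (0 : R)^'+, 0 < xi < 1.
  near=> xi; apply/andP; split; near: xi; first exact: nbhs_right_gt.
  exact: nbhs_right_lt.
have near1 : \forall xi \near (1 : R)^'-, 0 < xi < 1.
  near=> xi; apply/andP; split; near: xi; first exact: nbhs_left_gt.
  exact: nbhs_left_lt.
pose f (xi : R) := if 0 < xi < 1 then xi `^ p * v xi else 0.
pose dw (xi : R) := if 0 < xi < 1 then
  xi `^ (p + 1) * ((p + 2) * v xi `^ m - w xi) else 0.
have fE (xi : R) : 0 < xi < 1 -> f xi = xi `^ p * v xi by rewrite /f => ->.
have dwE (xi : R) : 0 < xi < 1 ->
  dw xi = xi `^ (p + 1) * ((p + 2) * v xi `^ m - w xi) by rewrite /dw => ->.
have f0 : f 0 = 0 by rewrite /f ltxx.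
have dw0 : dw 0 = 0 by rewrite /dw ltxx.
have f1 (xi : R) : 1 <= xi -> f xi = 0.
  by move=> xi1; rewrite /f [xi < 1]ltNge xi1 andbF.
have dw1 (xi : R) : 1 <= xi -> dw xi = 0.
  by move=> xi1; rewrite /dw [xi < 1]ltNge xi1 andbF.
have fpos (xi : R) : 0 < xi < 1 -> 0 < f xi.
  move=> xi01; rewrite fE// mulr_gt0 ?powR_gt0//; first by case/andP: xi01.
  by case/andP: (vc _ xi01).
have fge0 (xi : R) : 0 <= f xi.
  by have [/fpos/ltW//|nxi] := boolP (0 < xi < 1); rewrite /f (negbTE nxi).
have powl (r : R) : 0 < r -> xi `^ r @[xi --> 0^'+] --> 0 by exact: powR_cvg0.
have powr (r : R) : xi `^ r @[xi --> 1^'-] --> (1 : R).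
  rewrite -[X in _ --> X](congr1 (fun h => h r) (powR1 R)).
  exact: cvg_at_left_filter (continuous_powR _ r 1 ltr01).
have fl : f xi @[xi --> 0^'+] --> 0.
  rewrite -[X in _ --> X](mul0r c); apply: (cvg_near_eq _ _ _ _ _ _ near0 fE).
  exact: cvgM (powl p p0) vl.
have fr : f xi @[xi --> 1^'-] --> 0.
  rewrite -[X in _ --> X](mulr0 1); apply: (cvg_near_eq _ _ _ _ _ _ near1 fE).
  exact: cvgM (powr p) vr.
have vpos (F : set_system R) : Filter F -> (\forall xi \near F, 0 < xi < 1) ->
    \forall xi \near F, 0 <= v xi.
  by move=> FF nF; apply: (filterS _ nF) => xi /vc /andP[/ltW].
have vpl (r : R) : v xi `^ r @[xi --> 0^'+] --> c `^ r.
  exact: cvg_comp vl (continuous_powR _ r c c0).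
have vpr (r : R) : 0 < r -> v xi `^ r @[xi --> 1^'-] --> 0.
  by move=> r0; apply: cvg_powR0 => //; exact: vpos.
have p10 : 0 < p + 1 by lra.
have dwl : dw xi @[xi --> 0^'+] --> 0.
  have w_to0 : xi `^ (p + 1) * w xi @[xi --> 0^'+] --> 0.
    apply: (@squeeze_cvgr _ _ _ _ (fun=> 0) (fun xi => xi `^ (p + 1) * v xi `^ q)).
    - apply: filterS near0 => xi xi01; have /andP[w0 wv] := wq _ xi01.
      by rewrite mulr_ge0 ?powR_ge0//= ler_wpM2l ?powR_ge0.
    - exact: cvg_cst.
    - rewrite -[X in _ --> X](mul0r (c `^ q)).
      exact: cvgM (powl _ p10) (vpl q).
  have v_to0 : xi `^ (p + 1) * ((p + 2) * v xi `^ m) @[xi --> 0^'+] --> 0.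
    rewrite -[X in _ --> X](mul0r ((p + 2) * c `^ m)).
    by apply: cvgM; [exact: powl|apply: cvgM; [exact: cvg_cst|exact: vpl]].
  rewrite -[X in _ --> X](subrr 0); apply: (cvg_near_eq _ _ _ _ _ _ near0 _ (cvgB v_to0 w_to0)).
  by move=> xi /dwE ->; rewrite mulrBr.
have dwr : dw xi @[xi --> 1^'-] --> 0.
  have w_to0 : w xi @[xi --> 1^'-] --> 0.
    apply: (@squeeze_cvgr _ _ _ _ (fun=> 0) (fun xi => v xi `^ q)).
    - by apply: filterS near1 => xi xi01; exact: wq.
    - exact: cvg_cst.
    - exact: vpr.
  have v_to0 : (p + 2) * v xi `^ m @[xi --> 1^'-] --> 0.
    rewrite -[X in _ --> X](mulr0 (p + 2)).
    by apply: cvgM; [exact: cvg_cst|exact: vpr].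
  rewrite -[X in _ --> X](mulr0 1) -[X in 1 * X](subrr 0).
  apply: (cvg_near_eq _ _ _ _ _ _ near1 dwE).
  exact: cvgM (powr (p + 1)) (cvgB v_to0 w_to0).
have ode (xi : R) : 0 < xi < 1 -> is_derive xi 1 (fun t : R => f t `^ m) (dw xi) /\
    profile_ode N q sigma (p * beta) beta f dw xi.
  move=> xi01; apply: (@profile_of_emden R N m q sigma p beta xi f dw v w) => //.
  - by case/andP: (vc _ xi01).
  - exact: dv.
  - exact: hw.
have cf (xi : R) : 0 < xi < 1 -> {for xi, continuous f}.
  by move=> /ode[_ [/derivableP/is_derive1_continuous]].
have cdw (xi : R) : 0 < xi < 1 -> {for xi, continuous dw}.
  by move=> /ode[_ [_ /derivableP/is_derive1_continuous]].
split.
- exact: within_continuous_cutoff.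
- by move=> xi _; exact: fge0.
- exact: f0.
- by split=> // xi xi0 xi1; apply: fpos; rewrite xi0.
- exists dw; split=> //.
  + apply: C1_halfline_cutoff => //.
    * by rewrite -/(f 0) f0 powR0// gt_eqF.
    * by move=> xi xi1; rewrite -/(f xi) f1// powR0// gt_eqF.
    * by move=> xi /ode[].
    * by apply: cvg_powR0 => //; apply: nearW.
    * by apply: cvg_powR0 => //; apply: nearW.
    * exact: within_continuous_cutoff.
  + by rewrite dw1.
  + by move=> xi xi0 xi1; apply: (ode xi _).2; rewrite xi0.
Unshelve. all: by end_near. Qed.

Lemma eucl_norm_ge0 (R : realType) (N : nat) (x : 'rV[R]_N) : 0 <= eucl_norm x.
Proof. exact: sqrtr_ge0. Qed.

(** This is where the interface condition [dw 1 = 0] is used. *)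
Lemma emden_limits_of_profile (R : realType) (N : nat) (m q sigma p beta : R)
    (g : R -> R) :
  0 < m -> is_profile N m q sigma (p * beta) beta g ->
  exists dw : R -> R,
    let u t := g t / t `^ p in
    let w t := (p + 2) * u t `^ m - dw t / t `^ (p + 1) in
    [/\ forall xi : R, 0 < xi < 1 -> is_derive xi 1 (fun t : R => g t `^ m) (dw xi),
        forall xi : R, 0 < xi < 1 -> profile_ode N q sigma (p * beta) beta g dw xi,
        u xi @[xi --> 1^'-] --> 0 &
        w xi @[xi --> 1^'-] --> 0].
Proof.
move=> m0 [cg g0 g00 [gpos g1] [dw [[dgm _ cdw] dw0 dw1 ode]]].
have cvg1 (h : R -> R) : {within `[0, +oo[%classic, continuous h} ->
    h xi @[xi --> 1^'-] --> h 1.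
  case/continuous_within_itvcyP => ch _; apply: cvg_at_left_filter.
  by apply: ch; rewrite in_itv/= ltr01.
have pow1 (r : R) : (xi `^ r)^-1 @[xi --> 1^'-] --> (1 : R).
  rewrite -[X in _ --> X]invr1; apply: cvgV; first by rewrite oner_neq0.
  rewrite -[X in _ --> X](congr1 (fun h => h r) (powR1 R)).
  exact: cvg_at_left_filter (continuous_powR _ r 1 ltr01).
have near1 : \forall xi \near (1 : R)^'-, 0 < xi.
  by near=> xi; near: xi; exact: nbhs_left_gt.
have u1 : g xi / xi `^ p @[xi --> 1^'-] --> 0.
  rewrite -[X in _ --> X](mul0r 1); apply: cvgM; last exact: pow1.
  by rewrite -(g1 1 (lexx _)); exact: cvg1.
exists dw; split=> //.
- by move=> xi /andP[xi0 _]; exact: dgm.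
- by move=> xi /andP[xi0 xi1]; exact: ode.
- rewrite -[X in _ --> X](subrr 0); apply: cvgB.
    rewrite -[X in _ --> X](mulr0 (p + 2)); apply: cvgM; first exact: cvg_cst.
    apply: cvg_powR0 => //; apply: filterS near1 => xi xi0.
    by rewrite divr_ge0 ?powR_ge0// g0// ltW.
  rewrite -[X in _ --> X](mul0r 1); apply: cvgM; last exact: pow1.
  by rewrite -dw1; exact: cvg1.
Unshelve. all: by end_near. Qed.

Theorem theorem1p2 (R : realType) (N : nat) (m q sigma : R)
    (hN : (1 <= N)%N) (hm : 1 < m) (hq0 : 0 < q) (hq1 : q < 1)
    (hsigma : sigma = 2 * (1 - q) / (m - 1)) (hmq : 2 < m + q) :
  exists2 beta0 : R, 0 < beta0 &
  let alpha0 := 2 / (m - 1) * beta0 in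
  forall beta : R, beta0 <= beta ->
  let alpha := 2 / (m - 1) * beta in
  alpha0 <= alpha /\
  exists (U : R -> 'rV[R]_N -> R) (f : R -> R),
    [/\ exp_self_similar_solution m q sigma alpha beta U f,
        forall (V : R -> 'rV[R]_N -> R) (g : R -> R),
          exp_self_similar_solution m q sigma alpha beta V g ->
          (forall (t : R) (x : 'rV[R]_N), V t x = U t x) /\
          (forall xi : R, 0 <= xi -> g xi = f xi) &
        f = (fun xi : R =>
               ((m - 1) ^+ 2 / (2 * m * (N%:R * (m - 1) + 2))) `^ (m - q)^-1
                 * xi `^ (2 / (m - 1)))
            +o_ (0^'+) (fun xi : R => xi `^ (2 / (m - 1)))].
Proof.
set p := 2 / (m - 1).
have m1 : 0 < m - 1 by lra.
have p0 : 0 < p by rewrite divr_gt0.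
have n0 : 0 <= (N%:R : R) by exact: ler0n.
pose A : R := 2 * p + N%:R + 2.
pose B : R := (p + 2) * (p + N%:R).
have A0 : 0 <= A by rewrite /A; lra.
have B0 : 0 < B by rewrite mulr_gt0//; lra.
have BE : (m - 1) ^+ 2 / (2 * m * (N%:R * (m - 1) + 2)) = B^-1.
  have Nm : 0 <= N%:R * (m - 1) by rewrite mulr_ge0// ltW.
  rewrite /B /p; field; rewrite !gt_eqF//; lra.
rewrite BE; set c := B^-1 `^ (m - q)^-1.
have c0 : 0 < c by rewrite powR_gt0// invr_gt0.
have mq : m - q != 0 by rewrite gt_eqF//; lra.
have Bc : B * c `^ (m - q) = 1.
  by rewrite /c -powRrM mulVf// powRr1 ?divff ?gt_eqF// invr_ge0 ltW.
have hs : sigma = p * (1 - q) by rewrite hsigma /p; field; rewrite gt_eqF.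
pose beta0 := m * (A + B + 1) * c `^ (m - 1) + m.
have beta00 : 0 < beta0.
  rewrite ltr_wpDl//; last lra.
  by rewrite !mulr_ge0 ?powR_ge0//; lra.
exists beta0 => // alpha0 beta hbeta alpha; split; first by rewrite ler_pM2l.
have [kappa k0 [W hW]] :=
  phase_curve _ _ _ _ _ _ _ hm hq0 hq1 hmq A0 B0 c0 Bc hbeta.
have dW x xc := (hW x xc).2.
have hgt0 (x : R) : 0 < x < c -> 0 < excess m q B x.
  by case/andP=> x0 xc; apply: (@excess_gt0 R m q B c) => //; lra.
have W0h (x : R) : 0 < x < c -> 0 < W x <= excess m q B x.
  move=> xc; have [/andP[lW Wh] _] := hW _ xc; rewrite Wh andbT.
  apply: lt_le_trans lW; rewrite mulr_gt0// mulr_gt0 ?hgt0// powR_gt0//.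
  by case/andP: xc.
have [S [dS S0 Ssmall Slarge]] := phase_clock _ _ _ _ _ _ _ hm hq0 hq1 c0 Bc k0
  (fun x xc => (hW x xc).1) (fun x xc => is_derive1_continuous _ _ _ _ (dW x xc)).
have s0 (x : R) : 0 < x < c -> 0 < m * x `^ (m - 1) / W x.
  move=> xc; have /andP[? _] := W0h _ xc.
  by rewrite divr_gt0// mulr_gt0 ?powR_gt0//; [lra|case/andP: xc].
have [v [vc Sv vP dv0 [v1 v0]]] := clock_inverse _ _ _ _ dS s0 S0 Ssmall Slarge.
have dv (xi : R) : 0 < xi < 1 ->
    is_derive xi 1 v (- (W (v xi) / (m * v xi `^ (m - 1))) / xi).
  by move=> xi01; apply: (is_derive_eq (dv0 _ xi01)); rewrite invf_div.
have dWv (xi : R) : 0 < xi < 1 -> is_derive xi 1 (W \o v)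
    ((- (m * A * v xi `^ (m - 1) - beta) * (W (v xi) / (m * v xi `^ (m - 1)))
       - excess m q B (v xi)) / xi).
  move=> xi01; have vxc := vc _ xi01; have [x0 _] := andP xi01.
  apply: (is_derive_eq (@is_derive1_comp R W v xi _ _ (dW _ vxc) (dv _ xi01))).
  have [W0 _] := andP (W0h _ vxc); have [V0 _] := andP vxc.
  have Vm0 : 0 < v xi `^ (m - 1) by exact: powR_gt0.
  move: (W (v xi)) (v xi `^ (m - 1)) (excess m q B (v xi)) W0 Vm0 => Y V H Y0 V00.
  by field; rewrite !gt_eqF//; lra.
pose f (xi : R) : R := if 0 < xi < 1 then xi `^ p * v xi else 0.
have fprof : is_profile N m q sigma (p * beta) beta f.
  apply: (@is_profile_of_emden R N m q sigma p beta c v (W \o v)) => //.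
  move=> xi /vc /[dup] vxc /W0h /andP[W0 Wh]; rewrite /= (ltW W0).
  apply: le_trans Wh _; rewrite gerBl mulr_ge0 ?powR_ge0//; exact: ltW.
have uniq g : is_profile N m q sigma (p * beta) beta g ->
    forall xi : R, 0 <= xi -> g xi = f xi.
  move=> gprof xi; have m0 : 0 < m by lra.
  have [dw [dgm gode u1 w1]] := emden_limits_of_profile _ _ _ _ _ _ _ _ m0 gprof.
  have [_ _ g0 [gpos g1] _] := gprof.
  rewrite le_eqVlt => /predU1P[<-|xi0]; first by rewrite g0 /f ltxx.
  have [xi1|xi1] := ltP xi 1; last by rewrite g1// /f [xi < 1]ltNge xi1 andbF.
  have xi01 : 0 < xi < 1 by rewrite xi0.
  have sys (x : R) : 0 < x < 1 -> _ := fun x01 =>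
    emden_of_profile _ N m q sigma p beta x g dw hm erefl hs (andP x01).1
      (gpos _ (andP x01).1 (andP x01).2) (dgm _ x01) (gode _ x01).
  have := @emden_unique R m q A B c beta W S (fun t => g t / t `^ p) v
    (fun t => (p + 2) * (g t / t `^ p) `^ m - dw t / t `^ (p + 1))
    hm hq0 B0 W0h dW dS S0 Ssmall vc
    (fun x x01 => is_derive1_continuous _ _ _ _ (dv _ x01)) vP.
  move=> /(_ _ (fun x x01 => (sys x x01).1) (fun x x01 => (sys x x01).2) u1 w1 xi xi01).
  rewrite /f xi01 => <-; last first.
    move=> x /andP[x0 x1]; rewrite divr_gt0 ?powR_gt0//; exact: gpos.
  by rewrite mulrC mulfVK// gt_eqF// powR_gt0.
exists (fun t x => expR (- alpha * t) * f (eucl_norm x * expR (beta * t))), f.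
split.
- by split.
- move=> V g [gprof VE]; split; last exact: uniq.
  by move=> t x; rewrite VE (uniq g)// mulr_ge0 ?eucl_norm_ge0// expR_ge0.
- apply/eqaddoP => e e0; near=> xi.
  have xi01 : 0 < xi < 1.
    by apply/andP; split; near: xi; [exact: nbhs_right_gt|exact: nbhs_right_lt].
  have ve : `|c - v xi| < e by near: xi; move/cvgrPdist_lt : v0; exact.
  have -> : (f - (fun xi => c * xi `^ p)) xi = (v xi - c) * xi `^ p.
    by rewrite !fctE /f xi01 mulrBl [xi `^ p * _]mulrC.
  by rewrite normrM ler_wpM2r// distrC ltW.
Unshelve. all: by end_near. Qed.
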